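(* The NCE equation system for homogeneous minor players (consisting of systems (i) and (ii) given in the context) has a solution on $[0,T]$ if and only if asymptotic solvability holds for the sequence of Nash games with $N+1$ players described in the context.
   Context: **Data.** $T>0$, $\rho\ge0$, positive integers $n,n_1,n_2$. Constant matrices $A_0,F_0,A,F,G\in\mathbb{R}^{n\times n}$, $B_0,B\in\mathbb{R}^{n\times n_1}$, $D_0,D\in\mathbb{R}^{n\times n_2}$, $\Gamma_0,\Gamma_{0f},\Gamma_1,\Gamma_{1f},\Gamma_2,\Gamma_{2f}\in\mathbb{R}^{n\times n}$, vectors $\eta_0,\eta_{0f},\eta,\eta_f\in\mathbb{R}^n$, symmetric positive semidefinite $Q_0,Q_{0f},Q,Q_f\in\mathbb{R}^{n\times n}$, symmetric positive definite $R_0,R\in\mathbb{R}^{n_1\times n_1}$. $|z|_M^2=z^TMz$; $\otimes$ is the Kronecker product; $\|Z\|_{l_1}=\sum_{j,k}|z_{jk}|$. **The games.** For each $N$, the major player $\mathcal{A}_0$ and the minor players $\mathcal{A}_1,\dots,\mathcal{A}_N$ have dynamics $$dX_0=(A_0X_0+B_0u_0+F_0X^{(N)})dt+D_0dW_0,\qquad dX_i=(AX_i+Bu_i+FX^{(N)}+GX_0)dt+DdW_i,\quad 1\le i\le N,$$ with $X^{(N)}=\frac1N\sum_{k=1}^NX_k$ and independent standard $n_2$-dimensional Brownian motions $W_j$, independent of the independent initial states, and costs $$J_0=E\int_0^Te^{-\rho t}\big[|X_0-\Gamma_0X^{(N)}-\eta_0|_{Q_0}^2+|u_0|_{R_0}^2\big]dt+e^{-\rho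 T}E|X_0(T)-\Gamma_{0f}X^{(N)}(T)-\eta_{0f}|_{Q_{0f}}^2,$$ $$J_i=E\int_0^Te^{-\rho t}\big[|X_i-\Gamma_1X_0-\Gamma_2X^{(N)}-\eta|_Q^2+|u_i|_R^2\big]dt+e^{-\rho T}E|X_i(T)-\Gamma_{1f}X_0(T)-\Gamma_{2f}X^{(N)}(T)-\eta_f|_{Q_f}^2.$$ **Asymptotic solvability.** Let $\mathbf{1}_{k\times l}$ be the all-ones $k\times l$ matrix and $e_1^k,\dots,e_k^k$ the canonical basis of $\mathbb{R}^k$. Define $$\widehat{\boldsymbol{A}}=\mathrm{diag}[A_0,A,\dots,A]+\begin{bmatrix}0_{n\times n}&\mathbf{1}_{1\times N}\otimes\frac{F_0}{N}\\ \mathbf{1}_{N\times1}\otimes G&\mathbf{1}_{N\times N}\otimes\frac FN\end{bmatrix}\in\mathbb{R}^{(N+1)n\times(N+1)n},\qquad\widehat{\boldsymbol{A}}_{\rho/2}=\widehat{\boldsymbol{A}}-\tfrac\rho2I,$$ $$\boldsymbol{B}_0=e_1^{N+1}\otimes B_0,\qquad\boldsymbol{B}_k=e_{k+1}^{N+1}\otimes B\quad(1\le k\le N),$$ $$\boldsymbol{K}_0=[I_n,0,\dots,0]-\tfrac1N[0,\Gamma_0,\dots,\Gamma_0],\quad\boldsymbol{K}_{0f}=[I_n,0,\dots,0]-\tfrac1N[0,\Gamma_{0f},\dots,\Gamma_{0f}],$$ $$\boldsymbol{K}_i=[0,\dots,0,I_n,0,\dots,0]-[\Gamma_1,0,\dots,0]-\tfrac1N[0,\Gamma_2,\dots,\Gamma_2],$$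 $$\boldsymbol{K}_{if}=[0,\dots,0,I_n,0,\dots,0]-[\Gamma_{1f},0,\dots,0]-\tfrac1N[0,\Gamma_{2f},\dots,\Gamma_{2f}],$$ all in $\mathbb{R}^{n\times(N+1)n}$ written in $n\times n$ blocks, where in $\boldsymbol{K}_i,\boldsymbol{K}_{if}$ ($1\le i\le N$) $I_n$ is the $(i+1)$-th block. Put $\boldsymbol{Q}_0=\boldsymbol{K}_0^TQ_0\boldsymbol{K}_0$, $\boldsymbol{Q}_{0f}=\boldsymbol{K}_{0f}^TQ_{0f}\boldsymbol{K}_{0f}$, $\boldsymbol{Q}_i=\boldsymbol{K}_i^TQ\boldsymbol{K}_i$, $\boldsymbol{Q}_{if}=\boldsymbol{K}_{if}^TQ_f\boldsymbol{K}_{if}$. The Riccati ODE system for $(\boldsymbol{P}_0,\dots,\boldsymbol{P}_N)$, $\boldsymbol{P}_k(t)\in\mathbb{R}^{(N+1)n\times(N+1)n}$, is $$\begin{aligned}\dot{\boldsymbol{P}}_0=&-(\boldsymbol{P}_0\widehat{\boldsymbol{A}}_{\rho/2}+\widehat{\boldsymbol{A}}_{\rho/2}^T\boldsymbol{P}_0)+\boldsymbol{P}_0\boldsymbol{B}_0R_0^{-1}\boldsymbol{B}_0^T\boldsymbol{P}_0+\boldsymbol{P}_0\sum_{k=1}^N\boldsymbol{B}_kR^{-1}\boldsymbol{B}_k^T\boldsymbol{P}_k+\sum_{k=1}^N\boldsymbol{P}_k\boldsymbol{B}_kR^{-1}\boldsymbol{B}_k^T\boldsymbol{P}_0-\boldsymbol{Q}_0,\quad\boldsymbol{P}_0(T)=\boldsymbol{Q}_{0f},\end{aligned}$$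 and for $1\le i\le N$, $$\begin{aligned}\dot{\boldsymbol{P}}_i=&-(\boldsymbol{P}_i\widehat{\boldsymbol{A}}_{\rho/2}+\widehat{\boldsymbol{A}}_{\rho/2}^T\boldsymbol{P}_i)-\boldsymbol{P}_i\boldsymbol{B}_iR^{-1}\boldsymbol{B}_i^T\boldsymbol{P}_i+(\boldsymbol{P}_i\boldsymbol{B}_0R_0^{-1}\boldsymbol{B}_0^T\boldsymbol{P}_0+\boldsymbol{P}_0\boldsymbol{B}_0R_0^{-1}\boldsymbol{B}_0^T\boldsymbol{P}_i)\\&+\Big(\boldsymbol{P}_i\sum_{k=1}^N\boldsymbol{B}_kR^{-1}\boldsymbol{B}_k^T\boldsymbol{P}_k+\sum_{k=1}^N\boldsymbol{P}_k\boldsymbol{B}_kR^{-1}\boldsymbol{B}_k^T\boldsymbol{P}_i\Big)-\boldsymbol{Q}_i,\quad\boldsymbol{P}_i(T)=\boldsymbol{Q}_{if}.\end{aligned}$$ The sequence of games has *asymptotic solvability* if there exists $N_0$ such that for all $N\ge N_0$ this Riccati ODE system has a solution $(\boldsymbol{P}_0,\dots,\boldsymbol{P}_N)$ on $[0,T]$ and $\sup_{N\ge N_0,\,0\le t\le T}(\|\boldsymbol{P}_0(t)\|_{l_1}+\|\boldsymbol{P}_1(t)\|_{l_1})<\infty$. **NCE equation system (homogeneous minor players).** Unknowns: continuous functions on $[0,T]$ with $P_0(t)\in\mathbb{R}^{2n\times2n}$, $P_1(t)\in\mathbb{R}^{3n\times3n}$, $\overline A(t),\overline G(t)\in\mathbb{R}^{n\times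 n}$, $s_0(t)\in\mathbb{R}^{2n}$, $s_1(t)\in\mathbb{R}^{3n}$, $\overline m(t)\in\mathbb{R}^n$; $P_1=(P_{1,jk})_{1\le j,k\le3}$ with $n\times n$ blocks. Define $$\mathbb{A}_0=\begin{bmatrix}A_0&F_0\\ \overline G&\overline A\end{bmatrix},\quad\mathbb{B}_0=\begin{bmatrix}B_0\\0_{n\times n_1}\end{bmatrix},\quad\mathbb{M}_0=\begin{bmatrix}0_{n\times1}\\ \overline m\end{bmatrix},\quad\mathbb{A}=\begin{bmatrix}A&[G\ \ F]\\0_{2n\times n}&\mathbb{A}_0-\mathbb{B}_0R_0^{-1}\mathbb{B}_0^TP_0\end{bmatrix},$$ $$\mathbb{B}=\begin{bmatrix}B\\0_{2n\times n_1}\end{bmatrix},\quad\mathbb{M}=\begin{bmatrix}0_{n\times1}\\ \mathbb{M}_0-\mathbb{B}_0R_0^{-1}\mathbb{B}_0^Ts_0\end{bmatrix},$$ $$\mathbb{Q}_0=[I,-\Gamma_0]^TQ_0[I,-\Gamma_0],\quad\bar\eta_0=[I,-\Gamma_0]^TQ_0\eta_0,\quad\mathbb{Q}_{0f}=[I,-\Gamma_{0f}]^TQ_{0f}[I,-\Gamma_{0f}],\quad\bar\eta_{0f}=[I,-\Gamma_{0f}]^TQ_{0f}\eta_{0f},$$ $$\mathbb{Q}=[I,-\Gamma_1,-\Gamma_2]^TQ[I,-\Gamma_1,-\Gamma_2],\quad\bar\eta=[I,-\Gamma_1,-\Gamma_2]^TQ\eta,$$ $$\mathbb{Q}_f=[I,-\Gamma_{1f},-\Gamma_{2f}]^TQ_f[I,-\Gamma_{1f},-\Gamma_{2f}],\quad\bar\eta_f=[I,-\Gamma_{1f},-\Gamma_{2f}]^TQ_f\eta_f.$$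 System (i): $$\rho P_0=\dot P_0+P_0\mathbb{A}_0+\mathbb{A}_0^TP_0-P_0\mathbb{B}_0R_0^{-1}\mathbb{B}_0^TP_0+\mathbb{Q}_0,\quad P_0(T)=\mathbb{Q}_{0f},$$ $$\rho P_1=\dot P_1+P_1\mathbb{A}+\mathbb{A}^TP_1-P_1\mathbb{B}R^{-1}\mathbb{B}^TP_1+\mathbb{Q},\quad P_1(T)=\mathbb{Q}_f,$$ $$\overline A=A+F-BR^{-1}B^TP_{1,11}-BR^{-1}B^TP_{1,13},\qquad\overline G=G-BR^{-1}B^TP_{1,12}.$$ System (ii): $$\rho s_0=\dot s_0+(\mathbb{A}_0^T-P_0\mathbb{B}_0R_0^{-1}\mathbb{B}_0^T)s_0+P_0\mathbb{M}_0-\bar\eta_0,\quad s_0(T)=-\bar\eta_{0f},$$ $$\rho s_1=\dot s_1+(\mathbb{A}^T-P_1\mathbb{B}R^{-1}\mathbb{B}^T)s_1+P_1\mathbb{M}-\bar\eta,\quad s_1(T)=-\bar\eta_f,$$ $$\overline m=-BR^{-1}\mathbb{B}^Ts_1.$$ A solution is a set of continuous functions $(P_0,P_1,\overline A,\overline G,s_0,s_1,\overline m)$ on $[0,T]$, with $P_0(t)\in\mathbb{R}^{2n\times2n}$, $P_1(t)\in\mathbb{R}^{3n\times3n}$, $\overline A(t),\overline G(t)\in\mathbb{R}^{n\times n}$, $s_0(t)\in\mathbb{R}^{2n}$, $s_1(t)\in\mathbb{R}^{3n}$ and $\overline m(t)\in\mathbb{R}^n$, satisfying (i) and (ii) on $[0,T]$.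 *)

(* Defs.v *)
From HB Require Import structures.
From mathcomp Require Import all_boot all_order all_algebra.
From mathcomp Require Import all_classical all_reals all_analysis.

Set Implicit Arguments.
Unset Strict Implicit.
Unset Printing Implicit Defensive.

Import Order.TTheory GRing.Theory Num.Theory.
Import numFieldNormedType.Exports.

Local Open Scope classical_set_scope.
Local Open Scope ring_scope.

Section Generic.
Context {R : realType}.

Definition sym_psd n (M : 'M[R]_n) : Prop :=
  M^T = M /\ forall z : 'cV[R]_n, 0 <= (z^T *m M *m z) 0 0.

Definition sym_pd n (M : 'M[R]_n) : Prop :=
  M^T = M /\ forall z : 'cV[R]_n, z != 0 -> 0 < (z^T *m M *m z) 0 0.

Definition l1norm m n (Z : 'M[R]_(m, n)) : R := \sum_j \sum_k `|Z j k|.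

(* Two-sided at interior points of [0, T], one-sided at 0 and at T. *)
Definition is_deriv_on (T : R) m n (f : R -> 'M[R]_(m, n)) (t : R)
    (v : 'M[R]_(m, n)) : Prop :=
  (fun s : R => (s - t)^-1 *: (f s - f t)) @ within `[0, T] t^' --> v.

Definition ode_on (T : R) m n (f h : R -> 'M[R]_(m, n)) : Prop :=
  forall t : R, 0 <= t <= T -> is_deriv_on T f t (h t).

End Generic.

(* Index 0 refers to the major player; the subscript f marks terminal-cost
   coefficients; a bare underscore is the coefficient of the minor players.
   The diffusion coefficients D_0 and D_ enter neither the Riccati system nor
   the NCE system. *)
Record game_data (R : realType) (n n1 n2 : nat) := GameData {
  horizon : R;
  discount : R;
  A_0 : 'M[R]_n; F_0 : 'M[R]_n;
  A_ : 'M[R]_n; F_ : 'M[R]_n; G_ : 'M[R]_n;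
  B_0 : 'M[R]_(n, n1); B_ : 'M[R]_(n, n1);
  D_0 : 'M[R]_(n, n2); D_ : 'M[R]_(n, n2);
  Gamma_0 : 'M[R]_n; Gamma_0f : 'M[R]_n;
  Gamma_1 : 'M[R]_n; Gamma_1f : 'M[R]_n;
  Gamma_2 : 'M[R]_n; Gamma_2f : 'M[R]_n;
  eta_0 : 'cV[R]_n; eta_0f : 'cV[R]_n; eta_ : 'cV[R]_n; eta_f : 'cV[R]_n;
  Q_0 : 'M[R]_n; Q_0f : 'M[R]_n; Q_ : 'M[R]_n; Q_f : 'M[R]_n;
  R_0 : 'M[R]_n1; R_ : 'M[R]_n1
}.

(* (N + 1) n, in the form expected by the block matrix operations. *)
Definition joint_dim (n N : nat) : nat := (\sum_(j < N.+1) n)%N.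

Section AsymptoticSolvability.
Context {R : realType} {n n1 n2 : nat}.
Variable g : game_data R n n1 n2.

Section FixedN.
Variable N : nat.

(* [0, ..., 0, M, 0, ..., 0], with M in block i (numbered from 0) *)
Definition row_at (i : 'I_N.+1) (M : 'M[R]_n) : 'M[R]_(n, joint_dim n N) :=
  \mxrow_(j < N.+1) (if j == i then M else 0).

(* [0, M, ..., M] *)
Definition row_minors (M : 'M[R]_n) : 'M[R]_(n, joint_dim n N) :=
  \mxrow_(j < N.+1) (if j == ord0 then 0 else M).

(* Each Kronecker product with an all-ones matrix is written out as the block
   matrix all of whose blocks equal the second factor. *)
Definition Ahat : 'M[R]_(joint_dim n N) :=
  \mxdiag_(j < N.+1) (if j == ord0 then A_0 g else A_ g)
  + \mxblock_(j < N.+1, k < N.+1)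
      (if j == ord0 then (if k == ord0 then 0 else N%:R^-1 *: F_0 g)
       else (if k == ord0 then G_ g else N%:R^-1 *: F_ g)).

Definition Ahat_rho2 : 'M[R]_(joint_dim n N) := Ahat - (discount g / 2)%:M.

(* e_k (x) B_0 for k = 0 and e_k (x) B_ otherwise *)
Definition Bjoint (k : 'I_N.+1) : 'M[R]_(joint_dim n N, n1) :=
  \mxcol_(j < N.+1)
    (if j == k then (if k == ord0 then B_0 g else B_ g) else 0).

Definition K0 : 'M[R]_(n, joint_dim n N) :=
  row_at ord0 1%:M - N%:R^-1 *: row_minors (Gamma_0 g).

Definition K0f : 'M[R]_(n, joint_dim n N) :=
  row_at ord0 1%:M - N%:R^-1 *: row_minors (Gamma_0f g).

Definition K (i : 'I_N.+1) : 'M[R]_(n, joint_dim n N) :=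
  row_at i 1%:M - row_at ord0 (Gamma_1 g) - N%:R^-1 *: row_minors (Gamma_2 g).

Definition Kf (i : 'I_N.+1) : 'M[R]_(n, joint_dim n N) :=
  row_at i 1%:M - row_at ord0 (Gamma_1f g) - N%:R^-1 *: row_minors (Gamma_2f g).

Definition Q0joint : 'M[R]_(joint_dim n N) := K0^T *m Q_0 g *m K0.
Definition Q0fjoint : 'M[R]_(joint_dim n N) := K0f^T *m Q_0f g *m K0f.
Definition Qjoint (i : 'I_N.+1) : 'M[R]_(joint_dim n N) :=
  (K i)^T *m Q_ g *m K i.
Definition Qfjoint (i : 'I_N.+1) : 'M[R]_(joint_dim n N) :=
  (Kf i)^T *m Q_f g *m Kf i.

Definition major_rhs (P : 'I_N.+1 -> 'M[R]_(joint_dim n N)) :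
    'M[R]_(joint_dim n N) :=
  - (P ord0 *m Ahat_rho2 + Ahat_rho2^T *m P ord0)
  + P ord0 *m Bjoint ord0 *m invmx (R_0 g) *m (Bjoint ord0)^T *m P ord0
  + P ord0 *m
      (\sum_(k < N.+1 | k != ord0)
         Bjoint k *m invmx (R_ g) *m (Bjoint k)^T *m P k)
  + (\sum_(k < N.+1 | k != ord0)
       P k *m Bjoint k *m invmx (R_ g) *m (Bjoint k)^T) *m P ord0
  - Q0joint.

Definition minor_rhs (i : 'I_N.+1) (P : 'I_N.+1 -> 'M[R]_(joint_dim n N)) :
    'M[R]_(joint_dim n N) :=
  - (P i *m Ahat_rho2 + Ahat_rho2^T *m P i)
  - P i *m Bjoint i *m invmx (R_ g) *m (Bjoint i)^T *m P i
  + (P i *m Bjoint ord0 *m invmx (R_0 g) *m (Bjoint ord0)^T *m P ord0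
     + P ord0 *m Bjoint ord0 *m invmx (R_0 g) *m (Bjoint ord0)^T *m P i)
  + (P i *m
       (\sum_(k < N.+1 | k != ord0)
          Bjoint k *m invmx (R_ g) *m (Bjoint k)^T *m P k)
     + (\sum_(k < N.+1 | k != ord0)
          P k *m Bjoint k *m invmx (R_ g) *m (Bjoint k)^T) *m P i)
  - Qjoint i.

Definition riccati_solution (P : 'I_N.+1 -> R -> 'M[R]_(joint_dim n N)) :
    Prop :=
  [/\ ode_on (horizon g) (P ord0) (fun t => major_rhs (P ^~ t)),
      P ord0 (horizon g) = Q0fjoint,
      forall i : 'I_N.+1, i != ord0 ->
        ode_on (horizon g) (P i) (fun t => minor_rhs i (P ^~ t)) &
      forall i : 'I_N.+1, i != ord0 -> P i (horizon g) = Qfjoint i].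

End FixedN.

(* N counts minor players, hence 0 < N0; it also gives [inord 1] value 1. *)
Definition asymptotic_solvability : Prop :=
  exists (N0 : nat) (P : forall N : nat, 'I_N.+1 -> R -> 'M[R]_(joint_dim n N)),
    [/\ (0 < N0)%N,
        forall N : nat, (N0 <= N)%N -> riccati_solution (P N) &
        has_ubound [set x : R | exists (N : nat) (t : R),
          [/\ (N0 <= N)%N, 0 <= t <= horizon g &
              x = l1norm (P N ord0 t) + l1norm (P N (inord 1) t)]]].

End AsymptoticSolvability.

Section NCE.
Context {R : realType} {n n1 n2 : nat}.
Variable g : game_data R n n1 n2.

Local Notation T := (horizon g).
Local Notation rho := (discount g).
Local Notation dim2 := (n + n)%N.
Local Notation dim3 := (n + (n + n))%N.

Definition bbA0 (Abar Gbar : 'M[R]_n) : 'M[R]_dim2 :=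
  block_mx (A_0 g) (F_0 g) Gbar Abar.

Definition bbB0 : 'M[R]_(dim2, n1) := col_mx (B_0 g) 0.

Definition bbM0 (mbar : 'cV[R]_n) : 'cV[R]_dim2 := col_mx 0 mbar.

Definition bbA (P0 : 'M[R]_dim2) (Abar Gbar : 'M[R]_n) : 'M[R]_dim3 :=
  block_mx (A_ g) (row_mx (G_ g) (F_ g))
           0 (bbA0 Abar Gbar - bbB0 *m invmx (R_0 g) *m bbB0^T *m P0).

Definition bbB : 'M[R]_(dim3, n1) := col_mx (B_ g) 0.

Definition bbM (s0 : 'cV[R]_dim2) (mbar : 'cV[R]_n) : 'cV[R]_dim3 :=
  col_mx 0 (bbM0 mbar - bbB0 *m invmx (R_0 g) *m bbB0^T *m s0).

Definition row0 : 'M[R]_(n, dim2) := row_mx 1%:M (- Gamma_0 g).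
Definition row0f : 'M[R]_(n, dim2) := row_mx 1%:M (- Gamma_0f g).
Definition row1 : 'M[R]_(n, dim3) :=
  row_mx 1%:M (row_mx (- Gamma_1 g) (- Gamma_2 g)).
Definition row1f : 'M[R]_(n, dim3) :=
  row_mx 1%:M (row_mx (- Gamma_1f g) (- Gamma_2f g)).

Definition bbQ0 : 'M[R]_dim2 := row0^T *m Q_0 g *m row0.
Definition etabar0 : 'cV[R]_dim2 := row0^T *m Q_0 g *m eta_0 g.
Definition bbQ0f : 'M[R]_dim2 := row0f^T *m Q_0f g *m row0f.
Definition etabar0f : 'cV[R]_dim2 := row0f^T *m Q_0f g *m eta_0f g.
Definition bbQ : 'M[R]_dim3 := row1^T *m Q_ g *m row1.
Definition etabar : 'cV[R]_dim3 := row1^T *m Q_ g *m eta_ g.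
Definition bbQf : 'M[R]_dim3 := row1f^T *m Q_f g *m row1f.
Definition etabarf : 'cV[R]_dim3 := row1f^T *m Q_f g *m eta_f g.

Definition blk11 (M : 'M[R]_dim3) : 'M[R]_n := ulsubmx M.
Definition blk12 (M : 'M[R]_dim3) : 'M[R]_n := lsubmx (ursubmx M).
Definition blk13 (M : 'M[R]_dim3) : 'M[R]_n := rsubmx (ursubmx M).

(* The differential equations are solved for the derivative. *)
Definition nce_system_i (P0 : R -> 'M[R]_dim2) (P1 : R -> 'M[R]_dim3)
    (Abar Gbar : R -> 'M[R]_n) : Prop :=
  [/\ ode_on T P0 (fun t =>
        rho *: P0 t
        - (P0 t *m bbA0 (Abar t) (Gbar t) + (bbA0 (Abar t) (Gbar t))^T *m P0 t
           - P0 t *m bbB0 *m invmx (R_0 g) *m bbB0^T *m P0 t + bbQ0)) /\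
      P0 T = bbQ0f,
      ode_on T P1 (fun t =>
        rho *: P1 t
        - (P1 t *m bbA (P0 t) (Abar t) (Gbar t)
           + (bbA (P0 t) (Abar t) (Gbar t))^T *m P1 t
           - P1 t *m bbB *m invmx (R_ g) *m bbB^T *m P1 t + bbQ)) /\
      P1 T = bbQf,
      forall t : R, 0 <= t <= T ->
        Abar t = A_ g + F_ g
                 - B_ g *m invmx (R_ g) *m (B_ g)^T *m blk11 (P1 t)
                 - B_ g *m invmx (R_ g) *m (B_ g)^T *m blk13 (P1 t) &
      forall t : R, 0 <= t <= T ->
        Gbar t = G_ g - B_ g *m invmx (R_ g) *m (B_ g)^T *m blk12 (P1 t)].

Definition nce_system_ii (P0 : R -> 'M[R]_dim2) (P1 : R -> 'M[R]_dim3)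
    (Abar Gbar : R -> 'M[R]_n)
    (s0 : R -> 'cV[R]_dim2) (s1 : R -> 'cV[R]_dim3) (mbar : R -> 'cV[R]_n) :
    Prop :=
  [/\ ode_on T s0 (fun t =>
        rho *: s0 t
        - (((bbA0 (Abar t) (Gbar t))^T
            - P0 t *m bbB0 *m invmx (R_0 g) *m bbB0^T) *m s0 t
           + P0 t *m bbM0 (mbar t) - etabar0)) /\
      s0 T = - etabar0f,
      ode_on T s1 (fun t =>
        rho *: s1 t
        - (((bbA (P0 t) (Abar t) (Gbar t))^T
            - P1 t *m bbB *m invmx (R_ g) *m bbB^T) *m s1 t
           + P1 t *m bbM (s0 t) (mbar t) - etabar)) /\
      s1 T = - etabarf &
      forall t : R, 0 <= t <= T ->
        mbar t = - (B_ g *m invmx (R_ g) *m bbB^T *m s1 t)].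

Definition nce_solvable : Prop :=
  exists (P0 : R -> 'M[R]_dim2) (P1 : R -> 'M[R]_dim3)
         (Abar Gbar : R -> 'M[R]_n)
         (s0 : R -> 'cV[R]_dim2) (s1 : R -> 'cV[R]_dim3)
         (mbar : R -> 'cV[R]_n),
    [/\ [/\ {within `[0, T], continuous P0},
            {within `[0, T], continuous P1},
            {within `[0, T], continuous Abar} &
            {within `[0, T], continuous Gbar}],
        [/\ {within `[0, T], continuous s0},
            {within `[0, T], continuous s1} &
            {within `[0, T], continuous mbar}],
        nce_system_i P0 P1 Abar Gbar &
        nce_system_ii P0 P1 Abar Gbar s0 s1 mbar].

End NCE.

(* Main.v *)
Require Import Defs.
From mathcomp Require Import all_boot all_order all_algebra.
From mathcomp Require Import all_classical all_reals all_analysis.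
From mathcomp Require Import ring lra.

(** Write [x_0] for the state of the major player, [x_i] for that of a minor
    player and [m] for the mean of the minor states.  The coefficients of the games
    see the joint state only through the short vectors [(x_0, m)] for the major
    player and [(x_i, x_0, m)] for minor player [i].  If [S] and [S_i] denote the
    linear maps onto these vectors ([state2] and [state3]), then matrices of the
    form [P_0 = S^T L_0 S] and [P_i = (S_i)^T L_1 S_i], with [L_0] and [L_1]
    symmetric, are preserved by the joint Riccati system: the closed loop dynamics
    of the short vectors are autonomous ([state2_closed_loop],
    [state3_closed_loop]), and the system becomes a pair of equations for
    [(L_0, L_1)] whose size does not depend on [N] ([major_rhs_lifted],
    [minor_rhs_lifted]).  The right-hand side of this reduced system is a polynomial
    in the unknowns and in [eps = 1 / N], and at [eps = 0] it is exactly system (i)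
    of the NCE equations ([nce_system_i_reduced]).  System (ii) is linear once
    system (i) is solved ([reduced_nce]), so the theorem compares the reduced system
    at [eps = 0] with the one at small [eps = 1 / N].

    If system (i) has a solution on [[0, T]], continuous dependence on the
    parameter gives solutions of the reduced system for all small [eps], uniformly
    bounded ([perturbed_solution]).  They are symmetric ([riccati_symmetric]), hence
    lift to solutions of the games, and the sum of absolute values of the entries
    stays bounded because the rows of [S] and [S_i] have bounded sums
    ([nce_asymptotic]).

    Conversely, let solutions of the games be given, bounded for player 0 and
    player 1.  They are lifts: projecting a solution onto lifted families produces
    a defect that satisfies a homogeneous Lipschitz estimate and vanishes at
    [T] ([riccati_solution_lifted]).  Thus [(L_0, L_1)] solves the reduced system at
    [eps = 1 / N], and it is bounded uniformly in [N] because [S] and [S_1] have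
    right inverses with bounded entries.  Bounded solutions for arbitrarily small
    [eps] prevent the limit system from blowing up ([limit_solution]).

    The analysis behind both directions is Picard iteration and Gronwall's
    inequality for matrix equations on [[0, T]] solved backwards in time
    ([ode_exists], [gronwall]), applied to fields made globally Lipschitz by
    clamping the entries of the state. *)

Set Implicit Arguments.
Unset Strict Implicit.
Unset Printing Implicit Defensive.

Import Order.TTheory GRing.Theory Num.Theory.
Import numFieldNormedType.Exports.
Local Open Scope classical_set_scope.
Local Open Scope ring_scope.

(** * Matrix norms and derivatives on a closed interval *)

Section MatrixNorm.
Context {R : realType}.

Lemma mx_norm_leP m n (M : 'M[R]_(m, n)) (c : R) :
  0 <= c -> (`|M| <= c) <-> (forall i j, `|M i j| <= c).
Proof.
move=> c0; rewrite /Num.Def.normr/= mx_normrE; split.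
  by move=> /bigmax_leP[_ h] i j; exact: (h (i, j)).
by move=> h; apply/bigmax_leP; split => // -[i j] _; exact: h.
Qed.

Lemma ler_mx_entry m n (M : 'M[R]_(m, n)) i j : `|M i j| <= `|M|.
Proof. exact: (mx_norm_leP M (normr_ge0 M)).1. Qed.

Lemma ler_norm_mulmx m k n (A : 'M[R]_(m, k)) (B : 'M[R]_(k, n)) :
  `|A *m B| <= k%:R * `|A| * `|B|.
Proof.
apply/mx_norm_leP => [|i j]; first by rewrite !mulr_ge0.
rewrite mxE; apply: le_trans (ler_norm_sum _ _ _) _.
rewrite -mulrA mulr_natl -[X in _ *+ X]card_ord -sumr_const.
by apply: ler_sum => l _; rewrite normrM ler_pM// ler_mx_entry.
Qed.

Lemma norm_trmx m n (A : 'M[R]_(m, n)) : `|A^T| = `|A|.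
Proof.
have h p q (B : 'M[R]_(p, q)) : `|B^T| <= `|B|.
  by apply/mx_norm_leP => // i j; rewrite mxE ler_mx_entry.
by apply/eqP; rewrite eq_le h -{1}[A]trmxK h.
Qed.

Lemma linear_mxE p q p' q' (L : 'M[R]_(p, q) -> 'M[R]_(p', q')) :
  linear L -> [/\ L 0 = 0, {morph L : x y / x + y}, {morph L : x y / x - y} &
    forall a, {morph L : x / a *: x}].
Proof.
move=> linL.
have LD : {morph L : x y / x + y} by move=> x y; have := linL 1 x y; rewrite !scale1r.
have L0 : L 0 = 0 by apply: (addrI (L 0)); rewrite -LD !addr0.
have LZ a : {morph L : x / a *: x} by move=> x; rewrite -[a *: x]addr0 linL L0 addr0.
by split=> // x y; rewrite LD -scaleN1r LZ scaleN1r.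
Qed.

(** The values at the finitely many matrix units bound a linear map.  This is
    what lets every linear operation on matrices commute with [is_deriv_on]. *)
Lemma linear_mx_bounded p q p' q' (L : 'M[R]_(p, q) -> 'M[R]_(p', q')) :
  linear L -> exists2 C : R, 0 < C & forall X, `|L X| <= C * `|X|.
Proof.
move=> /linear_mxE[L0 LD _ LZ].
exists (1 + \sum_i \sum_j `|L (delta_mx i j)|).
  by rewrite ltr_pwDl// sumr_ge0// => i _; rewrite sumr_ge0.
move=> X; rewrite {1}(matrix_sum_delta X) (big_morph L LD L0).
rewrite mulrDl mul1r ler_wpDl//.
apply: le_trans (ler_norm_sum _ _ _) _; rewrite mulr_suml; apply: ler_sum => i _.
rewrite (big_morph L LD L0); apply: le_trans (ler_norm_sum _ _ _) _.
rewrite mulr_suml; apply: ler_sum => j _.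
by rewrite LZ normrZ mulrC ler_wpM2l// ler_mx_entry.
Qed.

End MatrixNorm.

Section DerivOn.
Context {R : realType}.
Variable T : R.

(** Clearing the denominator gives a form of the difference quotient that also
    makes sense at the point itself; the calculus rules below start from it. *)
Lemma is_deriv_onP m n (f : R -> 'M[R]_(m, n)) (t : R) v :
  is_deriv_on T f t v <->
  forall e, 0 < e -> exists2 d, 0 < d & forall s : R, 0 <= s <= T ->
    `|s - t| < d -> `|f s - f t - (s - t) *: v| <= e * `|s - t|.
Proof.
have key s : s != t ->
    `|f s - f t - (s - t) *: v| =
    `|v - (s - t)^-1 *: (f s - f t)| * `|s - t|.
  move=> st; have st0 : s - t != 0 by rewrite subr_eq0.
  rewrite [RHS]mulrC -normrZ scalerBr scalerA divff// scale1r -normrN.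
  by rewrite opprB.
split=> [/cvgrPdist_le h e e0|h].
  have := h e e0; rewrite near_withinE => /nbhs_ballP[d /= d0 hd].
  exists d => // s sT sd; have [->|st] := eqVneq s t.
    by rewrite !subrr scale0r subr0 !normr0 mulr0.
  rewrite key// ler_wpM2r//; apply: (hd s) => //.
  by rewrite /ball/= distrC.
apply/cvgrPdist_le => e e0; have [d d0 hd] := h e e0.
rewrite near_withinE; apply/nbhs_ballP; exists d => //= s.
rewrite /ball/= distrC => sd st; rewrite in_itv/= => sT.
have := hd s sT sd; rewrite key// ler_pM2r// normr_gt0 subr_eq0//.
Qed.

Lemma is_deriv_on_linear p q p' q' (L : 'M[R]_(p, q) -> 'M[R]_(p', q'))
    (f : R -> 'M[R]_(p, q)) (t : R) v :
  linear L -> is_deriv_on T f t v -> is_deriv_on T (L \o f) t (L v).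
Proof.
move=> linL /is_deriv_onP h; apply/is_deriv_onP => e e0.
have [C C0 hC] := linear_mx_bounded linL.
have [_ _ LB LZ] := linear_mxE linL.
have [d d0 hd] := h (e / C) (divr_gt0 e0 C0).
exists d => // s sT sd /=.
rewrite -LZ -!LB; apply: le_trans (hC _) _.
rewrite mulrC -ler_pdivlMr//; apply: le_trans (hd s sT sd) _.
by rewrite mulrAC.
Qed.

Lemma is_deriv_on_entries m n (f : R -> 'M[R]_(m, n)) (t : R) (v : 'M[R]_(m, n)) :
  (forall i j, is_deriv_on T (fun s => (f s i j)%:M : 'M[R]_1) t (v i j)%:M) <->
  is_deriv_on T f t v.
Proof.
split=> h; last first.
  move=> i j; apply: (is_deriv_on_linear (L := fun X => (X i j)%:M)) h => a x y.
  by apply/matrixP => k l; rewrite !mxE mulrnDl mulrnAr.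
apply/is_deriv_onP => e e0.
have /choice[d hd] : forall ij : 'I_m * 'I_n, exists d : R, 0 < d /\
    forall s : R, 0 <= s <= T -> `|s - t| < d ->
    `|f s ij.1 ij.2 - f t ij.1 ij.2 - (s - t) * v ij.1 ij.2| <= e * `|s - t|.
  move=> [i j]; have /is_deriv_onP/(_ e e0)[d d0 hd] := h i j.
  exists d; split => // s sT sd; apply: le_trans (hd s sT sd) => /=.
  by have := ler_mx_entry ((f s i j)%:M - (f t i j)%:M - (s - t) *: (v i j)%:M)
    ord0 (ord0 : 'I_1); rewrite !mxE eqxx !mulr1n.
exists (\big[Num.min/1]_ij d ij).
  apply: (big_ind (fun x : R => 0 < x)) => // [x y x0 y0|ij _].
    by rewrite lt_min x0.
  by case: (hd ij).
move=> s sT sd; apply/mx_norm_leP => [|i j]; first by rewrite mulr_ge0// ltW.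
rewrite !mxE; apply: (hd (i, j)).2 => //.
by apply: lt_le_trans sd _; rewrite (bigD1 (i, j))//= ge_min lexx.
Qed.

Lemma is_deriv_onD m n (f g : R -> 'M[R]_(m, n)) (t : R) u v :
  is_deriv_on T f t u -> is_deriv_on T g t v ->
  is_deriv_on T (fun s => f s + g s) t (u + v).
Proof.
move=> /is_deriv_onP hf /is_deriv_onP hg; apply/is_deriv_onP => e e0.
have e20 : 0 < e / 2 by rewrite divr_gt0.
have [d1 d10 h1] := hf _ e20; have [d2 d20 h2] := hg _ e20.
exists (Num.min d1 d2); first by rewrite lt_min d10.
move=> s sT; rewrite lt_min => /andP[sd1 sd2].
rewrite (_ : _ - _ = (f s - f t - (s - t) *: u) + (g s - g t - (s - t) *: v)).
  rewrite (le_trans (ler_normD _ _))// [e]splitr mulrDl.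
  by apply: lerD; [exact: h1|exact: h2].
by apply/matrixP => i j; rewrite !mxE; ring.
Qed.

Lemma is_deriv_onN m n (f : R -> 'M[R]_(m, n)) (t : R) u :
  is_deriv_on T f t u -> is_deriv_on T (fun s => - f s) t (- u).
Proof.
apply: (is_deriv_on_linear (L := fun X => - X)) => a x y.
by rewrite opprD scalerN.
Qed.

Lemma is_deriv_onB m n (f g : R -> 'M[R]_(m, n)) (t : R) u v :
  is_deriv_on T f t u -> is_deriv_on T g t v ->
  is_deriv_on T (fun s => f s - g s) t (u - v).
Proof. by move=> hf hg; apply/is_deriv_onD/is_deriv_onN. Qed.

Lemma is_deriv_on_mulmx p m n q (A : 'M[R]_(p, m)) (B : 'M[R]_(n, q))
    (f : R -> 'M[R]_(m, n)) (t : R) v :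
  is_deriv_on T f t v ->
  is_deriv_on T (fun s => A *m f s *m B) t (A *m v *m B).
Proof.
apply: (is_deriv_on_linear (L := fun X => A *m X *m B)) => a x y.
by rewrite mulmxDr mulmxDl -scalemxAr -scalemxAl.
Qed.

Lemma is_deriv_on_tr m n (f : R -> 'M[R]_(m, n)) (t : R) v :
  is_deriv_on T f t v -> is_deriv_on T (fun s => (f s)^T) t v^T.
Proof.
by apply: (is_deriv_on_linear (L := fun X => X^T)) => a x y; rewrite linearP.
Qed.

(** The derivative only sees the values on [[0, T]]: this carries every change
    of form of a right-hand side that is valid on that interval only. *)
Lemma is_deriv_on_eq m n (f g : R -> 'M[R]_(m, n)) (t : R) u v :
  0 <= t <= T -> (forall s : R, 0 <= s <= T -> f s = g s) -> u = v ->
  is_deriv_on T f t u -> is_deriv_on T g t v.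
Proof.
move=> tT fg <- /is_deriv_onP h; apply/is_deriv_onP => e /h[d d0 hd].
by exists d => // s sT sd; rewrite -!fg//; exact: hd.
Qed.

(** The counterpart of [is_deriv_onP] for continuity, so that both notions can
    be handled with the same inequalities at the end points. *)
Lemma within_contP m n (f : R -> 'M[R]_(m, n)) :
  {within `[0, T], continuous f} <->
  forall t : R, 0 <= t <= T -> forall e, 0 < e -> exists2 d, 0 < d &
    forall s : R, 0 <= s <= T -> `|s - t| < d -> `|f s - f t| <= e.
Proof.
split=> [/subspace_continuousP h t tT e e0|h].
  have /cvgrPdist_le/(_ e e0) : f x @[x --> within `[0, T] (nbhs t)] --> f t.
    by apply: h; rewrite /= in_itv.
  rewrite near_withinE => /nbhs_ballP[d /= d0 hd].
  exists d => // s sT sd; rewrite distrC; apply: (hd s).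
    by rewrite /ball/= distrC.
  by rewrite /= in_itv.
apply/subspace_continuousP => t /=; rewrite in_itv/= => tT.
apply/cvgrPdist_le => e e0; have [d d0 hd] := h t tT e e0.
rewrite near_withinE; apply/nbhs_ballP; exists d => //= s.
by rewrite /ball/= distrC in_itv/= => sd sT; rewrite distrC; exact: hd.
Qed.

Lemma ode_on_continuous m n (f h : R -> 'M[R]_(m, n)) :
  ode_on T f h -> {within `[0, T], continuous f}.
Proof.
move=> fh; apply/within_contP => t tT e e0.
have /is_deriv_onP/(_ 1 ltr01)[d d0 hd] := fh t tT.
have K0 : 0 < 1 + `|h t| by rewrite ltr_pwDl.
exists (Num.min d (e / (1 + `|h t|))); first by rewrite lt_min d0 divr_gt0.
move=> s sT; rewrite lt_min => /andP[sd se].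
rewrite -[f s - f t](subrK ((s - t) *: h t)).
apply: le_trans (ler_normD _ _) _; rewrite normrZ.
apply: le_trans (lerD (hd s sT sd) (lexx _)) _.
by rewrite mul1r -{1}[`|s - t|]mulr1 -mulrDr -ler_pdivlMr// ltW.
Qed.

Lemma within_cont_entry m n (f : R -> 'M[R]_(m, n)) i j :
  {within `[0, T], continuous f} ->
  {within `[0, T], continuous (fun t => f t i j)}.
Proof.
move=> /within_contP h; apply/subspace_continuousP => t /=.
rewrite in_itv/= => tT.
apply/cvgrPdist_le => e e0; have [d d0 hd] := h t tT e e0.
rewrite near_withinE; apply/nbhs_ballP; exists d => //= s.
rewrite /ball/= distrC in_itv/= => sd sT; apply: le_trans (hd s sT sd).
by have := ler_mx_entry (f s - f t) i j; rewrite !mxE distrC.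
Qed.

Lemma within_cont_bounded m n (f : R -> 'M[R]_(m, n)) :
  {within `[0, T], continuous f} ->
  exists2 M : R, 0 < M & forall t : R, 0 <= t <= T -> `|f t| <= M.
Proof.
move=> cf.
have := continuous_compact cf (@segment_compact _ 0 T).
move=> /compact_bounded[M [Mr hM]].
exists (Num.max 1 (M + 1)); first by rewrite lt_max ltr01.
move=> t tT; apply: (hM (Num.max 1 (M + 1))).
  by rewrite lt_max ltrDl ltr01 orbT.
by exists t => //=; rewrite in_itv.
Qed.

(** Away from the end points the one-sided restriction is vacuous, which gives
    access to the mean value theorem for real functions. *)
Lemma is_deriv_on_is_derive m n (f : R -> 'M[R]_(m, n)) (t : R) (v : 'M[R]_(m, n)) i j :
  0 < t < T -> is_deriv_on T f t v ->
  is_derive t 1 (fun s => f s i j : R^o) (v i j).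
Proof.
move=> /andP[t0 tT] /is_deriv_onP h.
suff cv : (fun h => h^-1 *: ((f (h *: 1 + t) i j : R^o) - f t i j)) @ 0^' --> v i j.
  apply: DeriveDef; first by apply/cvg_ex; exists (v i j).
  exact/cvg_lim.
apply/cvgrPdist_le => e e0; have [d d0 hd] := h e e0.
rewrite near_withinE; apply/nbhs_ballP.
exists (Num.min d (Num.min t (T - t))) => /=.
  by rewrite !lt_min d0 t0 subr_gt0.
move=> s; rewrite /ball/= sub0r normrN !lt_min => /and3P[sd st sT] s0.
rewrite [s *: 1]mulr1.
have sI : 0 <= s + t <= T.
  by move: st sT; rewrite !ltr_norml => /andP[? ?] /andP[? ?]; lra.
have := hd (s + t) sI; rewrite addrK => /(_ sd) hs.
have s1 : 0 < `|s| by rewrite normr_gt0.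
rewrite -(ler_pM2r s1) -normrM mulrBl.
rewrite [_ *: _ * s]mulrAC mulVf// mul1r.
apply: le_trans hs; rewrite distrC mulrC.
by have := ler_mx_entry (f (s + t) - f t - s *: v) i j; rewrite !mxE.
Qed.

End DerivOn.

(** * Comparison and Gronwall estimates *)

Section Comparison.
Context {R : realType}.
Variable T : R.

(** An exponential majorant of the derivative integrates to an exponential
    majorant of the function.  The maximum norm is not differentiable, but it is
    controlled entry by entry: each [c * expR (K * (T - t))] plus or minus an
    entry is nonincreasing and nonnegative at [T]. *)
Lemma ode_on_le_expR m n (y h : R -> 'M[R]_(m, n)) (K c : R) :
  0 <= K -> 0 <= c -> ode_on T y h ->
  (forall t : R, 0 <= t <= T -> `|h t| <= K * (c * expR (K * (T - t)))) ->
  `|y T| <= c ->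
  forall t : R, 0 <= t <= T -> `|y t| <= c * expR (K * (T - t)).
Proof.
move=> K0 c0 yh hle yT t tT.
have dE (x : R) : is_derive x 1 (fun s => c * expR (K * (T - s)) : R^o)
    (- (K * (c * expR (K * (T - x))))).
  apply: trigger_derive.
  by rewrite ?scaler0 ?mulr0 ?add0r /GRing.scale/=; ring.
have key (sg : bool) i j : 0 <= c * expR (K * (T - t)) + (-1) ^+ sg * y t i j.
  pose w s := c * expR (K * (T - s)) + (-1) ^+ sg * y s i j.
  have wT : 0 <= w T.
    rewrite /w subrr mulr0 expR0 mulr1.
    have := le_trans (ler_mx_entry (y T) i j) yT.
    by case: (sg); rewrite ?expr1 ?expr0 ler_norml => /andP[? ?]; lra.
  have dw (x : R) : 0 < x < T -> is_derive x 1 (w : R -> R^o)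
     (- (K * (c * expR (K * (T - x)))) + (-1) ^+ sg * h x i j).
    move=> xT; apply: is_deriveD; apply: is_deriveZ.
   
    apply: (is_deriv_on_is_derive _ _ xT); apply: yh.
    by case/andP: (xT) => /ltW -> /ltW ->.
  apply: le_trans wT _.
  case/andP: (tT) => t0 tT'.
  have w1 (x : R) : x \in `]0, T[%R -> derivable (w : R -> R^o) x (1 : R).
    by rewrite in_itv/= => /dw [].
  have w2 (x : R) : x \in `]0, T[%R -> derive1 (w : R -> R^o) x <= 0.
    rewrite in_itv/= => xT; have [_] := dw x xT.
    rewrite derive1E => ->.
    have xT' : 0 <= x <= T by case/andP: xT => /ltW -> /ltW ->.
    have := le_trans (ler_mx_entry (h x) i j) (hle x xT').
    by case: (sg); rewrite ?expr1 ?expr0 ler_norml => /andP[? ?]; lra.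
  have cw : {within `[0, T], continuous w}.
    have cE : {within `[0, T], continuous (fun s => c * expR (K * (T - s)))}.
      apply: continuous_subspaceT => s.
      by apply/differentiable_continuous/derivable1_diffP; case: (dE s).
    have cy : {within `[0, T], continuous (fun s => y s i j)}.
      exact: within_cont_entry (ode_on_continuous yh).
    apply/subspace_continuousP => s sT; apply: cvgD.
      by move/subspace_continuousP: cE; exact.
    by apply: cvgMr; move/subspace_continuousP: cy; exact.
  by apply: (ler0_derive1_le_cc w1 w2 cw) => //; rewrite in_itv/= ?lexx ?tT ?(le_trans t0).
apply/mx_norm_leP => [|i j]; first by rewrite mulr_ge0// expR_ge0.
rewrite ler_norml; have := key true i j; have := key false i j.
by rewrite expr0 expr1; lra.
Qed.


(** Instead of differentiating a norm, the bound is improved repeatedly.  With the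
    weight [w t = expR (2 * L * (T - t))], a bound [(M + e / L) * w] on [y] makes
    the derivative at most [(L * M + 2 * e) * w], which is [2 * L] times
    [(M / 2 + e / L) * w] and integrates to that.  Boundedness on the compact
    interval starts the induction. *)
Lemma gronwall m n (y h : R -> 'M[R]_(m, n)) (L e : R) :
  0 < L -> 0 <= e -> ode_on T y h -> y T = 0 ->
  (forall t : R, 0 <= t <= T -> `|h t| <= L * `|y t| + e) ->
  forall t : R, 0 <= t <= T -> `|y t| <= e / L * expR (2 * L * (T - t)).
Proof.
move=> L0 e0 yh yT hle.
have [M M0 hM] := within_cont_bounded (ode_on_continuous yh).
have E1 t : 0 <= t <= T -> 1 <= expR (2 * L * (T - t)).
  move=> /andP[_ tT]; rewrite -expR0 ler_expR mulr_ge0 ?subr_ge0//.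
  by rewrite mulr_ge0// ltW.
have eL : 0 <= e / L by rewrite divr_ge0// ltW.
have Mk k : 0 <= M * 2^-1 ^+ k by rewrite mulr_ge0 ?exprn_ge0// ltW.
(* The distance of the constant to the fixed point e / L is halved each time. *)
have it k (t : R) : 0 <= t <= T ->
    `|y t| <= (M * 2^-1 ^+ k + e / L) * expR (2 * L * (T - t)).
  elim: k t => [|k IH] t tT.
    apply: le_trans (hM t tT) _; rewrite expr0 mulr1.
    by rewrite -[X in X <= _]mulr1 ler_pM// ?E1 ?lerDl// ltW.
  apply: (ode_on_le_expR _ _ yh) => //; first by rewrite mulr_ge0// ltW.
  - by rewrite addr_ge0.
  - move=> s sT; apply: le_trans (hle s sT) _.
    have -> : 2 * L * ((M * 2^-1 ^+ k.+1 + e / L) * expR (2 * L * (T - s))) =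
        L * ((M * 2^-1 ^+ k + e / L) * expR (2 * L * (T - s)))
        + e * expR (2 * L * (T - s)).
      by rewrite exprS; field; rewrite gt_eqF.
    rewrite lerD//; first by rewrite ler_wpM2l ?IH// ltW.
    by rewrite -{1}[e]mulr1 ler_wpM2l ?E1.
  - by rewrite yT normr0 addr_ge0.
move=> t tT.
have cv : (fun k => (M * 2^-1 ^+ k + e / L) * expR (2 * L * (T - t))) @ \oo -->
    (M * 0 + e / L) * expR (2 * L * (T - t)).
  apply: cvgMl; apply: cvgD; last exact: cvg_cst.
  by apply: cvgMr; apply: cvg_expr; rewrite ger0_norm// invf_lt1 ?ltr1n.
rewrite mulr0 add0r in cv.
rewrite -(cvg_lim _ cv)//; apply: limr_ge; first by apply/cvg_ex; eexists; exact: cv.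
by apply: nearW => k; exact: it.
Qed.

End Comparison.

(** * Antiderivatives of continuous matrix functions *)

Section Antiderivative.
Context {R : realType}.
Variable T : R.

Lemma is_derive_is_deriv_on (F : R -> R) (t v : R) :
  is_derive t (1 : R) (F : R -> R^o) v ->
  is_deriv_on T (fun s => (F s)%:M : 'M[R]_1) t v%:M.
Proof.
move=> [/cvg_ex[/= l Fl] dv].
have lv : l = v by rewrite -dv; apply/esym/cvg_lim.
subst l => {dv}; apply/is_deriv_onP => e e0.
move/cvgrPdist_le : Fl => /(_ e e0); rewrite near_withinE => /nbhs_ballP[d /= d0 hd].
exists d => // s sT sd; apply/mx_norm_leP => [|i j].
  by rewrite mulr_ge0// ltW.
rewrite !mxE !ord1 eqxx !mulr1n.
have [->|st] := eqVneq s t; first by rewrite !subrr mul0r subr0 normr0 mulr0.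
have st0 : s - t != 0 by rewrite subr_eq0.
have := hd (s - t); rewrite /ball/= sub0r normrN => /(_ sd st0).
rewrite [_ *: 1]mulr1 subrK => h.
rewrite (_ : F s - F t - (s - t) * v = - ((s - t) * (v - (s - t)^-1 *: (F s - F t)))).
  by rewrite normrN normrM mulrC ler_wpM2r.
by rewrite mulrBr /GRing.scale/= mulrA divff// mul1r; ring.
Qed.

(** Freezing [u] outside [[0, T]] extends it continuously to the line, and the
    integral is started at [-1]: every point of [[0, T]] is then interior, so the
    fundamental theorem of calculus gives a two-sided derivative there. *)
Lemma antiderivative (T0 : 0 <= T) m n (u : R -> 'M[R]_(m, n)) (c : 'M[R]_(m, n)) :
  {within `[0, T], continuous u} ->
  exists2 U : R -> 'M[R]_(m, n), ode_on T U u & U T = c.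
Proof.
move=> cu.
pose clamp (t : R) := Num.min T (Num.max 0 t).
have clampT (t : R) : 0 <= clamp t <= T.
  by rewrite /clamp le_min T0 le_max lexx/= ge_min lexx.
have clampE (t : R) : 0 <= t <= T -> clamp t = t.
  by move=> /andP[t0 tT]; rewrite /clamp max_r// min_r.
have clamp1 (s t : R) : `|clamp s - clamp t| <= `|s - t|.
  have := ler_norm (s - t); have := ler_norm (- (s - t)); rewrite normrN.
  rewrite ler_norml /clamp; move: (`|s - t|) => d ? ?.
  case: (lerP 0 s) => ?; case: (lerP 0 t) => ?; rewrite /Num.min;
  by do ![case: ifPn; rewrite -?leNgt => ?]; apply/andP; split; lra.
pose v i j t := u (clamp t) i j.
have cv i j : continuous (v i j).
  move=> t; apply/cvgrPdist_le => e e0.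
  move/within_contP : cu => /(_ _ (clampT t) e e0)[d d0 hd].
  apply/nbhs_ballP; exists d => // s; rewrite /ball/= distrC => sd.
  rewrite distrC; apply: le_trans (hd _ (clampT s) _).
    by have := ler_mx_entry (u (clamp s) - u (clamp t)) i j; rewrite !mxE.
  exact: le_lt_trans sd.
pose F i j x := (\int[lebesgue_measure]_(t in `[-1, x]) (v i j t))%R.
have dF i j (x : R) : 0 <= x <= T -> is_derive x (1 : R) (F i j : R -> R^o) (v i j x).
  move=> /andP[x0 xT].
  have [] := @continuous_FTC1_closed R (v i j) (-1) x (T + 1).
  - by rewrite (le_lt_trans xT)// ltrDl.
  - apply: continuous_compact_integrable; first exact: segment_compact.
    exact: continuous_subspaceT.
  - by rewrite (lt_le_trans _ x0)// ltrN10.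
  - exact: cv.
  by move=> dF <-; rewrite derive1E; exact: derivableP.
exists (fun t => \matrix_(i, j) (F i j t - F i j T + c i j)).
  move=> t tT; apply/is_deriv_on_entries => i j.
  apply: (is_deriv_on_eq (f := fun s => (F i j s)%:M - (F i j T - c i j)%:M)
     (u := (v i j t)%:M - 0) tT).
  - move=> s _; rewrite mxE; apply/matrixP => k l.
    by rewrite !mxE -!mulrnBl opprB addrA addrAC.
  - by rewrite subr0 /v clampE.
  - apply: is_deriv_onB; first by apply: is_derive_is_deriv_on; exact: dF.
    apply/is_deriv_onP => e e0; exists 1 => // s _ _.
    by rewrite subrr scaler0 subr0 normr0 mulr_ge0// ltW.
by apply/matrixP => i j; rewrite mxE subrr add0r.
Qed.

End Antiderivative.

(** * Existence for globally Lipschitz equations *)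

Section Picard.
Context {R : realType}.

Lemma geometric_small (C e : R) : 0 < e -> exists k, C * 2^-1 ^+ k <= e.
Proof.
move=> e0.
have cv : (fun k => C * 2^-1 ^+ k) @ \oo --> C * 0.
  by apply: cvgMr; apply: cvg_expr; rewrite ger0_norm// invf_lt1 ?ltr1n.
rewrite mulr0 in cv; move/cvgrPdist_le : cv => /(_ e e0)[k _ hk].
exists k; have := hk k (leqnn k); rewrite sub0r normrN.
exact: le_trans (ler_norm _).
Qed.

(** The error bound is explicit because it is used uniformly in the time
    variable. *)
Lemma geometric_limit m n (z : nat -> 'M[R]_(m, n)) (E : R) :
  (forall k, `|z k.+1 - z k| <= E * 2^-1 ^+ k) ->
  exists l, forall k, `|l - z k| <= 2 * E * 2^-1 ^+ k.
Proof.
move=> hz.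
have E0 : 0 <= E.
  by have := le_trans (normr_ge0 _) (hz 0%N); rewrite expr0 mulr1.
have hkj k j : `|z (k + j)%N - z k| <= 2 * E * 2^-1 ^+ k * (1 - 2^-1 ^+ j).
  elim: j => [|j IH]; first by rewrite addn0 subrr normr0 subrr mulr0.
  rewrite addnS -(subrKA (z (k + j)%N)).
  apply: le_trans (ler_normD _ _) _.
  apply: le_trans (lerD (hz _) IH) _.
  rewrite exprD [in X in _ <= X]exprS le_eqVlt; apply/orP; left.
  by apply/eqP; field.
have hkj' k j : `|z (k + j)%N - z k| <= 2 * E * 2^-1 ^+ k.
  apply: le_trans (hkj k j) _; rewrite ler_piMr //.
    by rewrite mulr_ge0 ?mulr_ge0 ?exprn_ge0.
have cz : cvg (z @ \oo).
  apply: cauchy_cvg; apply: cauchy_exP => e e0.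
  have [k hk] := geometric_small (2 * E) (divr_gt0 e0 (ltr0n R 2)).
  exists (z k); exists k => // j /= kj.
  rewrite -ball_normE /= -(subnKC kj) distrC.
  apply: le_lt_trans (hkj' _ _) _; apply: le_lt_trans hk _.
  by rewrite ltr_pdivrMr// ltr_pMr// ltr1n.
exists (lim (z @ \oo)) => k; apply/ler_addgt0Pr => e e0.
move/cvgrPdist_le : cz => /(_ e e0)[j _ hj].
rewrite -(subrKA (z (k + j)%N)); apply: le_trans (ler_normD _ _) _.
by rewrite addrC lerD//; apply: hj; rewrite /= leq_addl.
Qed.

(** Picard iteration, carried out backwards from the terminal time.  In the
    weight [expR (2 * L * (T - t))] one iteration halves the distance between
    successive approximations, so they converge on the whole interval at once,
    without a restriction on its length.

    Continuity of [f] is asked for along continuous curves, which is the only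
    way it is used. *)
Theorem ode_exists (T L : R) m n (f : R -> 'M[R]_(m, n) -> 'M[R]_(m, n))
    (yT : 'M[R]_(m, n)) :
  0 <= T -> 0 < L ->
  (forall y, {within `[0, T], continuous y} ->
     {within `[0, T], continuous (fun t => f t (y t))}) ->
  (forall t : R, 0 <= t <= T -> forall x y, `|f t x - f t y| <= L * `|x - y|) ->
  exists2 y, ode_on T y (fun t => f t (y t)) & y T = yT.
Proof.
move=> T0 L0 fcont flip.
(* The Picard operator, given an arbitrary value at discontinuous curves. *)
have /choice[S hS] (y : R -> 'M[R]_(m, n)) : exists U,
    {within `[0, T], continuous y} ->
    ode_on T U (fun t => f t (y t)) /\ U T = yT.
  have [cy|ncy] := pselect {within `[0, T], continuous y}; last by exists y.
  by have [U ? ?] := antiderivative T0 yT (fcont y cy); exists U.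
pose ys k := iter k S (fun=> yT).
have cys k : {within `[0, T], continuous (ys k)}.
  elim: k => [|k IH]; first by exact: (continuous_subspaceT (@cst_continuous _ _ _)).
  exact: ode_on_continuous (hS _ IH).1.
have [M M0 hM] := within_cont_bounded (fcont _ (cys 0%N)).
have L20 : 0 <= 2 * L by rewrite mulr_ge0// ltW.
pose c := M / (2 * L).
have c0 : 0 <= c by rewrite divr_ge0// ltW.
have E1 (t : R) : 0 <= t <= T -> 1 <= expR (2 * L * (T - t)).
  move=> /andP[_ tT]; rewrite -[X in X <= _]expR0 ler_expR mulr_ge0 ?subr_ge0//.
have ET (t : R) : 0 <= t <= T -> expR (2 * L * (T - t)) <= expR (2 * L * T).
  by move=> /andP[t0 _]; rewrite ler_expR ler_wpM2l// lerBlDr lerDl.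
have step k (t : R) : 0 <= t <= T ->
    `|ys k.+1 t - ys k t| <= c * 2^-1 ^+ k * expR (2 * L * (T - t)).
  elim: k t => [|k IH] t tT.
    rewrite expr0 mulr1.
    have h := (hS _ (cys 0%N)).1.
    apply: (@ode_on_le_expR _ T _ _ (fun t => ys 1%N t - ys 0%N t)
      (fun t => f t (ys 0%N t) - 0)) => //.
    - move=> s sT; apply: is_deriv_onB; first exact: h.
      apply/is_deriv_onP => e e0; exists 1 => // r _ _.
      by rewrite subrr scaler0 subr0 normr0 mulr_ge0// ltW.
    - move=> s sT; rewrite subr0; apply: le_trans (hM s sT) _.
      rewrite mulrA mulrCA divff ?mulr1 ?mulf_neq0 ?gt_eqF//.
      by rewrite ler_peMr ?E1// ltW.
    - by rewrite [ys 1%N T](hS _ (cys 0%N)).2 subrr normr0.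
  have h1 := hS _ (cys k.+1); have h0 := hS _ (cys k).
  apply: (@ode_on_le_expR _ T _ _ (fun t => ys k.+2 t - ys k.+1 t)
     (fun t => f t (ys k.+1 t) - f t (ys k t))) => //.
  - by rewrite mulr_ge0// exprn_ge0.
  - by move=> s sT; apply: is_deriv_onB; [exact: h1.1|exact: h0.1].
  - move=> s sT; apply: le_trans (flip s sT _ _) _.
    apply: le_trans (ler_wpM2l (ltW L0) (IH s sT)) _.
    by rewrite exprS le_eqVlt; apply/orP; left; apply/eqP; field.
  - by rewrite [ys k.+2 T]h1.2 [ys k.+1 T]h0.2 subrr normr0 mulr_ge0// exprn_ge0.
pose E := c * expR (2 * L * T).
have E0 : 0 <= E by rewrite mulr_ge0// expR_ge0.
have /choice[y hy] (t : R) : exists l, 0 <= t <= T ->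
    forall k, `|l - ys k t| <= 2 * E * 2^-1 ^+ k.
  have [tT|tT] := boolP (0 <= t <= T); last by exists 0.
  have [|l hl] := @geometric_limit _ _ (ys ^~ t) E; last by exists l.
  move=> k; apply: le_trans (step k t tT) _.
  by rewrite mulrAC ler_wpM2r ?exprn_ge0// ler_wpM2l// ET.
have cy : {within `[0, T], continuous y}.
  apply/within_contP => t tT e e0.
  have e30 : 0 < e / 3 by rewrite divr_gt0.
  have [k hk] := geometric_small (2 * E) e30.
  move/within_contP : (cys k) => /(_ t tT _ e30)[d d0 hd].
  exists d => // s sT sd.
  rewrite (_ : y s - y t = (y s - ys k s) + (ys k s - ys k t) - (y t - ys k t)).
    apply: le_trans (ler_normB _ _) _.
    apply: le_trans (lerD (ler_normD _ _) (lexx _)) _.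
    have := hd s sT sd; have := le_trans (hy s sT k) hk.
    have := le_trans (hy t tT k) hk; lra.
  by apply/matrixP => i j; rewrite !mxE; ring.
(* The next iterates converge both to y and to its image Z, hence y = Z. *)
have [zd zT] := hS _ cy; set Z := S y in zd zT.
have yZ t : 0 <= t <= T -> y t = Z t.
  move=> tT; apply/eqP; rewrite -subr_eq0 -normr_eq0; apply/eqP/le_anti.
  rewrite normr_ge0 andbT; apply/ler_addgt0Pr => e e0; rewrite add0r.
  have [k hk] := geometric_small (E * (1 + expR (2 * L * T))) e0.
  have h0 := hS _ (cys k).
  have hZ : `|ys k.+1 t - Z t| <= (E * 2^-1 ^+ k) * expR (2 * L * (T - t)).
    apply: (@ode_on_le_expR _ T _ _ (fun t => ys k.+1 t - Z t)
       (fun t => f t (ys k t) - f t (y t))) => //.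
    - by rewrite mulr_ge0// exprn_ge0.
    - by move=> s sT; apply: is_deriv_onB; [exact: h0.1|exact: zd].
    - move=> s sT; apply: le_trans (flip s sT _ _) _.
      rewrite distrC; apply: le_trans (ler_wpM2l (ltW L0) (hy s sT k)) _.
      rewrite [leLHS](_ : _ = 2 * L * (E * 2^-1 ^+ k)); last by ring.
      by rewrite ler_wpM2l// ler_peMr ?E1// mulr_ge0// exprn_ge0.
    - by rewrite [ys k.+1 T]h0.2 zT subrr normr0 mulr_ge0// exprn_ge0.
  rewrite -(subrKA (ys k.+1 t)); apply: le_trans (ler_normD _ _) _.
  apply: le_trans (lerD (hy t tT _) hZ) _; apply: le_trans hk.
  rewrite [leRHS](_ : _ =
    2 * E * 2^-1 ^+ k.+1 + E * 2^-1 ^+ k * expR (2 * L * T)); last first.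
    by rewrite exprS; field.
  by rewrite lerD2l ler_wpM2l ?ET// mulr_ge0// exprn_ge0.
exists Z => // t tT.
by apply: (is_deriv_on_eq tT _ _ (zd t tT)) => //; rewrite yZ.
Qed.

End Picard.

(** * Lipschitz bounds for matrix-valued expressions *)

Section BoundedLipschitz.
Context {R : realType} {X : Type}.
Variable close : X -> X -> R -> Prop.

(** The relation [close x y d] means that [x] and [y] are admissible and at
    distance at most [d].  Keeping it abstract lets the same product rule serve
    balls in a space of matrices, pairs with a parameter, functions of time at a
    fixed time, and families of matrices.  A bound is part of the notion because
    the product rule needs it. *)
Definition bounded_lipschitz p q (f : X -> 'M[R]_(p, q)) : Prop :=
  exists2 C : R, 0 <= C & forall x y d, close x y d -> 0 <= d ->
    [/\ `|f x| <= C, `|f y| <= C & `|f x - f y| <= C * d].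

Lemma lip_bounded p q (f : X -> 'M[R]_(p, q)) : bounded_lipschitz f ->
  exists C, forall x, close x x 0 -> `|f x| <= C.
Proof. by move=> [C _ hC]; exists C => x /hC[]. Qed.

Lemma lip_cst p q (A : 'M[R]_(p, q)) : bounded_lipschitz (fun=> A).
Proof.
by exists `|A| => // x y d _ d0; rewrite subrr normr0 mulr_ge0.
Qed.

Lemma lip_linear p q p' q' (L : 'M[R]_(p, q) -> 'M[R]_(p', q')) f :
  linear L -> bounded_lipschitz f -> bounded_lipschitz (fun x => L (f x)).
Proof.
move=> linL [C C0 hC]; have [_ _ LB _] := linear_mxE linL.
have [M M0 hM] := linear_mx_bounded linL.
exists (M * C) => [|x y d kxy d0]; first by rewrite mulr_ge0// ltW.
have [fx fy fxy] := hC x y d kxy d0.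
have M0' := ltW M0.
split; [| |rewrite -LB -mulrA];
  by apply: le_trans (hM _) _; rewrite ler_wpM2l.
Qed.

Lemma lipN p q (f : X -> 'M[R]_(p, q)) :
  bounded_lipschitz f -> bounded_lipschitz (fun x => - f x).
Proof. by apply: lip_linear => a x y; rewrite opprD scalerN. Qed.

Lemma lipD p q (f g : X -> 'M[R]_(p, q)) :
  bounded_lipschitz f -> bounded_lipschitz g ->
  bounded_lipschitz (fun x => f x + g x).
Proof.
move=> [C C0 hC] [D D0 hD]; exists (C + D); first by rewrite addr_ge0.
move=> x y d kxy d0; have [fx fy fxy] := hC x y d kxy d0.
have [gx gy gxy] := hD x y d kxy d0.
split; try by apply: le_trans (ler_normD _ _) _; rewrite lerD.
by rewrite opprD addrACA mulrDl; apply: le_trans (ler_normD _ _) _; rewrite lerD.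
Qed.

Lemma lipB p q (f g : X -> 'M[R]_(p, q)) :
  bounded_lipschitz f -> bounded_lipschitz g ->
  bounded_lipschitz (fun x => f x - g x).
Proof. by move=> hf hg; apply/lipD/lipN. Qed.

Lemma lip_sum (I : Type) (r : seq I) (P : pred I) p q (f : I -> X -> 'M[R]_(p, q)) :
  (forall i, P i -> bounded_lipschitz (f i)) ->
  bounded_lipschitz (fun x => \sum_(i <- r | P i) f i x).
Proof.
move=> hf; elim: r => [|i r IH].
  rewrite (_ : (fun _ => _) = fun=> 0); first exact: lip_cst.
  by apply/funext => x; rewrite big_nil.
have [Pi|nPi] := boolP (P i).
  rewrite (_ : (fun _ => _) = (fun x => f i x + \sum_(j <- r | P j) f j x)).
    exact: lipD (hf i Pi) IH.
  by apply/funext => x; rewrite big_cons Pi.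
rewrite (_ : (fun _ => _) = (fun x => \sum_(j <- r | P j) f j x))//.
by apply/funext => x; rewrite big_cons (negbTE nPi).
Qed.

Lemma lipM p k q (f : X -> 'M[R]_(p, k)) (g : X -> 'M[R]_(k, q)) :
  bounded_lipschitz f -> bounded_lipschitz g ->
  bounded_lipschitz (fun x => f x *m g x).
Proof.
move=> [C C0 hC] [D D0 hD]; exists (k%:R * C * D + k%:R * C * D).
  by rewrite addr_ge0// !mulr_ge0.
have M0 : 0 <= k%:R * C * D by rewrite !mulr_ge0.
have nM p' q' (A : 'M[R]_(p', k)) (B : 'M[R]_(k, q')) a b :
    `|A| <= a -> `|B| <= b -> `|A *m B| <= k%:R * a * b.
  move=> Aa Bb; apply: le_trans (ler_norm_mulmx _ _) _.
  by apply: ler_pM => //; rewrite ?mulr_ge0// ler_wpM2l.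
move=> x y d kxy d0; have [fx fy fxy] := hC x y d kxy d0.
have [gx gy gxy] := hD x y d kxy d0.
split.
- by apply: le_trans (nM _ _ _ _ _ _ fx gx) _; rewrite lerDl.
- by apply: le_trans (nM _ _ _ _ _ _ fy gy) _; rewrite lerDl.
rewrite (_ : _ - _ = f x *m (g x - g y) + (f x - f y) *m g y); last first.
  by rewrite mulmxBr mulmxBl subrKA.
apply: le_trans (ler_normD _ _) _.
apply: le_trans (lerD (nM _ _ _ _ _ _ fx gxy) (nM _ _ _ _ _ _ fxy gy)) _.
by rewrite le_eqVlt; apply/orP; left; apply/eqP; ring.
Qed.

Lemma lipZ p q (a : R) (f : X -> 'M[R]_(p, q)) :
  bounded_lipschitz f -> bounded_lipschitz (fun x => a *: f x).
Proof.
apply: lip_linear => b x y.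
by rewrite scalerDr !scalerA mulrC.
Qed.

Lemma lip_tr p q (f : X -> 'M[R]_(p, q)) :
  bounded_lipschitz f -> bounded_lipschitz (fun x => (f x)^T).
Proof. by apply: lip_linear => a x y; rewrite linearP. Qed.

Lemma lip_row_mx p q q' (f : X -> 'M[R]_(p, q)) (g : X -> 'M[R]_(p, q')) :
  bounded_lipschitz f -> bounded_lipschitz g ->
  bounded_lipschitz (fun x => row_mx (f x) (g x)).
Proof.
move=> hf hg.
rewrite (_ : (fun _ => _) =
  (fun x => f x *m row_mx 1%:M 0 + g x *m row_mx 0 1%:M)).
  by apply: lipD; apply: lipM => //; exact: lip_cst.
apply/funext => x.
by rewrite !mul_mx_row !mulmx1 !mulmx0 add_row_mx addr0 add0r.
Qed.

Lemma lip_col_mx p p' q (f : X -> 'M[R]_(p, q)) (g : X -> 'M[R]_(p', q)) :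
  bounded_lipschitz f -> bounded_lipschitz g ->
  bounded_lipschitz (fun x => col_mx (f x) (g x)).
Proof.
move=> hf hg.
rewrite (_ : (fun _ => _) = (fun x => (row_mx (f x)^T (g x)^T)^T)).
  by apply: lip_tr; apply: lip_row_mx; exact: lip_tr.
by apply/funext => x; rewrite tr_row_mx !trmxK.
Qed.

Lemma lip_block_mx p p' q q' (f : X -> 'M[R]_(p, q)) (g : X -> 'M[R]_(p, q'))
    (h : X -> 'M[R]_(p', q)) (k : X -> 'M[R]_(p', q')) :
  bounded_lipschitz f -> bounded_lipschitz g ->
  bounded_lipschitz h -> bounded_lipschitz k ->
  bounded_lipschitz (fun x => block_mx (f x) (g x) (h x) (k x)).
Proof. by move=> *; apply: lip_col_mx; exact: lip_row_mx. Qed.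

Lemma lip_lsubmx p q q' (f : X -> 'M[R]_(p, q + q')) :
  bounded_lipschitz f -> bounded_lipschitz (fun x => lsubmx (f x)).
Proof. by apply: lip_linear => a x y; rewrite linearP. Qed.

Lemma lip_rsubmx p q q' (f : X -> 'M[R]_(p, q + q')) :
  bounded_lipschitz f -> bounded_lipschitz (fun x => rsubmx (f x)).
Proof. by apply: lip_linear => a x y; rewrite linearP. Qed.

Lemma lip_usubmx p q q' (f : X -> 'M[R]_(q + q', p)) :
  bounded_lipschitz f -> bounded_lipschitz (fun x => usubmx (f x)).
Proof. by apply: lip_linear => a x y; rewrite linearP. Qed.

Lemma lip_dsubmx p q q' (f : X -> 'M[R]_(q + q', p)) :
  bounded_lipschitz f -> bounded_lipschitz (fun x => dsubmx (f x)).
Proof. by apply: lip_linear => a x y; rewrite linearP. Qed.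

End BoundedLipschitz.

Section Clamp.
Context {R : realType}.

(** An entrywise retraction onto the ball of radius [r] of the maximum norm; it
    does not increase distances and turns a locally Lipschitz field into a
    globally Lipschitz one. *)
Definition mxclamp p q (r : R) (A : 'M[R]_(p, q)) : 'M[R]_(p, q) :=
  map_mx (fun a => Num.min r (Num.max (- r) a)) A.

Lemma mxclamp_id p q (r : R) (A : 'M[R]_(p, q)) : `|A| <= r -> mxclamp r A = A.
Proof.
move=> Ar; apply/matrixP => i j; rewrite mxE.
have := le_trans (ler_mx_entry A i j) Ar; rewrite ler_norml => /andP[h1 h2].
by rewrite max_r// min_r.
Qed.

Lemma mxclamp_le p q (r : R) (A : 'M[R]_(p, q)) : 0 <= r -> `|mxclamp r A| <= r.
Proof.
move=> r0; apply/mx_norm_leP => // i j; rewrite mxE ler_norml.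
by rewrite le_min ge_min lexx le_max lexx/= andbT; lra.
Qed.

Lemma mxclamp_lip p q (r : R) (A B : 'M[R]_(p, q)) : 0 <= r ->
  `|mxclamp r A - mxclamp r B| <= `|A - B|.
Proof.
move=> r0; apply/mx_norm_leP => // i j; rewrite !mxE.
have := ler_mx_entry (A - B) i j; rewrite !mxE !ler_norml.
move: (`|A - B|) (A i j) (B i j) => d a b /andP[h1 h2].
case: (lerP (- r) a) => ?; case: (lerP (- r) b) => ?; rewrite /Num.min;
by do ![case: ifPn; rewrite -?leNgt => ?]; apply/andP; split; lra.
Qed.

End Clamp.

(** * Perturbation of the vector field, uniqueness and symmetry *)

Section Perturbation.
Context {R : realType} {p q : nat}.
Variables (T : R) (T0 : 0 <= T) (F : R -> 'M[R]_(p, q) -> 'M[R]_(p, q)).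
Variable yT : 'M[R]_(p, q).

Definition param_ball (r : R) (x y : R * 'M[R]_(p, q)) (d : R) : Prop :=
  [/\ 0 <= x.1 <= 1, 0 <= y.1 <= 1, `|x.2| <= r, `|y.2| <= r &
      `|x.1 - y.1| <= d /\ `|x.2 - y.2| <= d].

Hypothesis F_lip : forall r, bounded_lipschitz (param_ball r) (fun x => F x.1 x.2).

Definition clamped (r eps : R) (y : 'M[R]_(p, q)) := F eps (mxclamp r y).

Lemma clamped_lip (r : R) : 0 <= r -> exists2 C : R, 0 < C &
  forall e e' : R, 0 <= e <= 1 -> 0 <= e' <= 1 -> forall x y,
  `|clamped r e x - clamped r e' y| <= C * `|e - e'| + C * `|x - y|.
Proof.
move=> r0; have [C C0 hC] := F_lip r.
exists (C + 1) => [|e e' e01 e'01 x y]; first by rewrite ltr_wpDl.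
have C1 : C <= C + 1 by rewrite lerDl.
pose d := `|e - e'| + `|x - y|.
have d0 : 0 <= d by rewrite addr_ge0.
have [|//|_ _ h] := hC (e, mxclamp r x) (e', mxclamp r y) d.
  split => //=; do ?[exact: mxclamp_le]; split; first by rewrite lerDl.
  by apply: le_trans (mxclamp_lip _ _ r0) _; rewrite lerDr.
apply: le_trans h _; rewrite -mulrDr.
by rewrite ler_wpM2r.
Qed.

Lemma clamped_exists (r e : R) : 0 <= r -> 0 <= e <= 1 ->
  exists2 y, ode_on T y (fun t => clamped r e (y t)) & y T = yT.
Proof.
move=> r0 e01; have [C C0 hC] := clamped_lip r0.
have lip x y : `|clamped r e x - clamped r e y| <= C * `|x - y|.
  by have := hC e e e01 e01 x y; rewrite subrr normr0 mulr0 add0r.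
apply: (ode_exists (f := fun=> clamped r e) yT T0 C0) => // y /within_contP cy.
apply/within_contP => t tT d d0.
have [c c0 hc] := cy t tT (d / C) (divr_gt0 d0 C0).
exists c => // s sT st; apply: le_trans (lip _ _) _.
by rewrite mulrC -ler_pdivlMr// hc.
Qed.

(** Continuous dependence on the parameter, at a linear rate: the difference of
    the two fields is at most [C] times the sum of the distance of the parameters
    and the distance of the states, and Gronwall absorbs the second part. *)
Lemma clamped_close (r : R) : 0 <= r -> exists2 C : R, 0 < C &
  forall e e' : R, 0 <= e <= 1 -> 0 <= e' <= 1 -> forall x y,
  ode_on T x (fun t => clamped r e (x t)) -> x T = yT ->
  ode_on T y (fun t => clamped r e' (y t)) -> y T = yT ->
  forall t : R, 0 <= t <= T -> `|x t - y t| <= C * `|e - e'|.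
Proof.
move=> r0; have [C C0 hC] := clamped_lip r0.
exists (expR (2 * C * T)); first exact: expR_gt0.
move=> e e' e01 e'01 x y hx xT hy yT' t tT.
have := @gronwall _ T _ _ (fun t => x t - y t) _ C (C * `|e - e'|) C0 _
  (fun t tT => is_deriv_onB (hx t tT) (hy t tT)).
rewrite xT yT' subrr mulr_ge0 ?(ltW C0)// => /(_ isT erefl) h.
have {}h : `|x t - y t| <= C * `|e - e'| / C * expR (2 * C * (T - t)).
  by apply: h => // s _; rewrite [leRHS]addrC; exact: hC.
apply: le_trans h _.
rewrite [C * _]mulrC mulfK ?gt_eqF// mulrC ler_wpM2r// ler_expR ler_wpM2l//.
  by rewrite mulr_ge0// ltW.
by case/andP: tT => t0 _; lra.
Qed.

Lemma solution_unclamped (r e : R) y : 0 <= r ->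
  (forall t : R, 0 <= t <= T -> `|y t| <= r) ->
  ode_on T y (fun t => clamped r e (y t)) <-> ode_on T y (fun t => F e (y t)).
Proof.
move=> r0 yr.
split=> h t tT; apply: is_deriv_on_eq (h t tT) => //;
by rewrite /clamped mxclamp_id// yr.
Qed.

(** A solution on all of [[0, T]] survives a small perturbation of the field.
    The perturbed field is cut off one unit outside the ball that contains
    the given solution; by [clamped_close] its global solution stays within
    that unit, hence never feels the cutoff.  The bound does not depend
    on the parameter. *)
Theorem perturbed_solution y0 :
  ode_on T y0 (fun t => F 0 (y0 t)) -> y0 T = yT ->
  exists r, exists2 d, 0 < d & forall e, 0 <= e <= d ->
    exists y, [/\ ode_on T y (fun t => F e (y t)), y T = yT &
                  forall t : R, 0 <= t <= T -> `|y t| <= r].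
Proof.
move=> h0 y0T.
have [M M0 hM] := within_cont_bounded (ode_on_continuous h0).
have r0 : 0 <= M + 1 by rewrite addr_ge0// ltW.
have [C C0 hC] := clamped_close r0.
have I01 : 0 <= (0 : R) <= 1 by rewrite lexx ler01.
have y0r (t : R) : 0 <= t <= T -> `|y0 t| <= M + 1.
  by move=> tT; apply: le_trans (hM t tT) _; rewrite lerDl.
have {}h0 := (solution_unclamped 0 r0 y0r).2 h0.
exists (M + 1), (Num.min 1 C^-1); first by rewrite lt_min ltr01 invr_gt0.
move=> e; rewrite le_min => /and3P[e0 e1 eC].
have e01 : 0 <= e <= 1 by rewrite e0.
have [y hy yTE] := clamped_exists r0 e01.
have yr (t : R) : 0 <= t <= T -> `|y t| <= M + 1.
  move=> tT; rewrite -[y t](subrK (y0 t)) addrC; apply: le_trans (ler_normD _ _) _.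
  rewrite lerD ?hM//; apply: le_trans (hC _ _ e01 I01 _ _ hy yTE h0 y0T t tT) _.
  by rewrite subr0 ger0_norm// mulrC -ler_pdivlMr// div1r.
by exists y; split; [exact: (solution_unclamped e r0 yr).1 hy|exact: yTE|exact: yr].
Qed.

(** Conversely, bounded solutions for arbitrarily small parameters exclude
    blow-up of the limit equation: its cut-off solution is close to one of them,
    hence stays where the cutoff acts as the identity. *)
Theorem limit_solution (r : R) : 0 <= r ->
  (forall d : R, 0 < d -> exists e y, [/\ 0 <= e <= d,
     ode_on T y (fun t => F e (y t)), y T = yT &
     forall t : R, 0 <= t <= T -> `|y t| <= r]) ->
  exists2 y0, ode_on T y0 (fun t => F 0 (y0 t)) & y0 T = yT.
Proof.
move=> r0 hF.
have r10 : 0 <= r + 1 by rewrite addr_ge0.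
have [C C0 hC] := clamped_close r10.
have I01 : 0 <= (0 : R) <= 1 by rewrite lexx ler01.
have [y0 h0 y0T] := clamped_exists r10 I01.
have d0 : 0 < Num.min 1 C^-1 by rewrite lt_min ltr01 invr_gt0.
have [e [y [ed hy yTE yr]]] := hF _ d0.
move: ed; rewrite le_min => /and3P[e0 e1 eC].
have e01 : 0 <= e <= 1 by rewrite e0.
have yr1 (t : R) : 0 <= t <= T -> `|y t| <= r + 1.
  by move=> tT; apply: le_trans (yr t tT) _; rewrite lerDl.
have {}hy := (solution_unclamped e r10 yr1).2 hy.
exists y0; last exact: y0T.
apply: ((solution_unclamped 0 r10 _).1 h0) => t tT.
rewrite -[y0 t](subrK (y t)) addrC; apply: le_trans (ler_normD _ _) _.
rewrite lerD ?yr//; apply: le_trans (hC _ _ I01 e01 _ _ h0 y0T hy yTE t tT) _.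
by rewrite sub0r normrN ger0_norm// mulrC -ler_pdivlMr// div1r.
Qed.

End Perturbation.

Section ParamBall.
Context {R : realType} {p q : nat}.

Lemma lip_state r : bounded_lipschitz (@param_ball R p q r) (fun x => x.2).
Proof.
exists (`|r| + 1); first by rewrite addr_ge0.
have r1 : r <= `|r| + 1 by rewrite (le_trans (ler_norm _))// lerDl.
move=> x y d [_ _ xr yr [_ xyd]] d0; split; try exact: le_trans r1.
by rewrite (le_trans xyd)// ler_peMl// lerDr.
Qed.

(** The parameter ranges over a bounded interval, so multiplying by it is
    harmless, jointly with the state. *)
Lemma lip_param_scale p' q' r (f : R * 'M[R]_(p, q) -> 'M[R]_(p', q')) :
  bounded_lipschitz (param_ball r) f ->
  bounded_lipschitz (param_ball r) (fun x => x.1 *: f x).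
Proof.
move=> hf; rewrite (_ : (fun _ => _) = (fun x => x.1%:M *m f x)); last first.
  by apply/funext => x; rewrite mul_scalar_mx.
apply: lipM => //; exists 1 => // x y d [/andP[x0 x1] /andP[y0 y1] _ _ [xyd _]] d0.
have h (a : R) b : 0 <= b -> `|a| <= b -> `|a%:M : 'M[R]_p'| <= b.
  move=> b0 ab; apply/mx_norm_leP => // i j; rewrite mxE.
  by case: (i == j); rewrite ?mulr1n ?mulr0n ?normr0.
by split; rewrite -?raddfB ?mul1r; apply: h => //; rewrite ger0_norm.
Qed.

Lemma lip_within_continuous T p' q' (f : R * 'M[R]_(p, q) -> 'M[R]_(p', q'))
    (Y : R -> 'M[R]_(p, q)) :
  (forall r, bounded_lipschitz (param_ball r) f) ->
  {within `[0, T], continuous Y} -> {within `[0, T], continuous (fun t => f (0, Y t))}.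
Proof.
move=> hf cY; have [r r0 hr] := within_cont_bounded cY.
have [C C0 hC] := hf r.
apply/within_contP => t tT e e0.
have Cp : 0 < C + 1 by rewrite ltr_wpDl.
have [d d0 hd] := (within_contP _ _).1 cY t tT (e / (C + 1)) (divr_gt0 e0 Cp).
exists d => // s sT sd.
have [||_ _ h] := hC (0, Y s) (0, Y t) `|Y s - Y t|.
- by split; rewrite /= ?lexx ?ler01 ?hr ?subrr ?normr0.
- by [].
apply: le_trans h _; apply: (@le_trans _ _ ((C + 1) * `|Y s - Y t|)).
  by rewrite ler_wpM2r// lerDl.
by rewrite mulrC -ler_pdivlMr// hd.
Qed.

End ParamBall.

Section RiccatiSymmetry.
Context {R : realType}.
Variables (T : R).

Lemma ode_unique p q (Z W hZ hW : R -> 'M[R]_(p, q)) (C : R) :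
  ode_on T Z hZ -> ode_on T W hW -> Z T = W T ->
  (forall t : R, 0 <= t <= T -> `|hZ t - hW t| <= C * `|Z t - W t|) ->
  forall t : R, 0 <= t <= T -> Z t = W t.
Proof.
move=> dZ dW ZWT hle t tT; apply/eqP; rewrite -subr_eq0 -normr_eq0.
apply/eqP/le_anti; rewrite normr_ge0 andbT.
have C1 : 0 < `|C| + 1 by rewrite ltr_wpDl.
have := @gronwall _ T _ _ (fun t => Z t - W t) _ (`|C| + 1) 0 C1 (lexx _)
  (fun t tT => is_deriv_onB (dZ t tT) (dW t tT)).
rewrite ZWT subrr => /(_ erefl) h.
rewrite -[leRHS](mul0r (expR (2 * (`|C| + 1) * (T - t)))).
rewrite -[X in _ <= X * _](mul0r (`|C| + 1)^-1); apply: h => // s sT.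
rewrite addr0; apply: le_trans (hle s sT) _; rewrite ler_wpM2r//.
by rewrite (le_trans (ler_norm _))// lerDl.
Qed.

Lemma trmx_riccati p (X A S Q : 'M[R]_p) (c : R) : S^T = S -> Q^T = Q ->
  (c *: X - (X *m A + A^T *m X - X *m S *m X + Q))^T =
  c *: X^T - (X^T *m A + A^T *m X^T - X^T *m S *m X^T + Q).
Proof.
move=> ST QT.
have E (x a b e q : 'M[R]_p) : (c *: x - (a + b - e + q))^T =
    c *: x^T - (a^T + b^T - e^T + q^T) by apply/matrixP => i j; rewrite !mxE.
by rewrite E QT !trmx_mul trmxK ST mulmxA [A^T *m _ + _]addrC.
Qed.

(** The transpose solves the same equation with the same terminal value, because
    the coefficient [A] is here a given function of time even when it was
    obtained from the solution itself. *)
Lemma riccati_symmetric p (X A : R -> 'M[R]_p) (a c : R) (S Q : 'M[R]_p) :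
  (forall t : R, 0 <= t <= T -> `|A t| <= a) -> S^T = S -> Q^T = Q ->
  ode_on T X (fun t => c *: X t - (X t *m A t + (A t)^T *m X t
                                   - X t *m S *m X t + Q)) ->
  (X T)^T = X T -> forall t : R, 0 <= t <= T -> (X t)^T = X t.
Proof.
move=> hA ST QT hX XT t0 t0T.
pose h (x : R * 'M[R]_p) := c *: x.2 - (x.2 *m A x.1 + (A x.1)^T *m x.2
                                   - x.2 *m S *m x.2 + Q).
have a0 : 0 <= a := le_trans (normr_ge0 _) (hA t0 t0T).
have [r r0 hr] := within_cont_bounded (ode_on_continuous hX).
pose K (x y : R * 'M[R]_p) d := [/\ 0 <= x.1 <= T, x.1 = y.1, `|x.2| <= r,
  `|y.2| <= r & `|x.2 - y.2| <= d].
have h2 : bounded_lipschitz K (fun x => x.2).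
  exists (r + 1); first by rewrite addr_ge0// ltW.
  have r1 : r <= r + 1 by rewrite lerDl.
  move=> x y d [xT xy xr yr xyd] d0; split; try exact: le_trans r1.
  by rewrite (le_trans xyd)// ler_peMl// lerDr ltW.
have hAl : bounded_lipschitz K (fun x => A x.1).
  exists a => // x y d [xT xy xr yr xyd] d0; rewrite -xy subrr normr0.
  by rewrite mulr_ge0//; split => //; exact: hA.
have [C C0 hC] : bounded_lipschitz K h.
  apply: lipB; first exact: lipZ.
  apply: lipD; last exact: lip_cst.
  apply: lipB; last by apply: lipM => //; apply: lipM => //; exact: lip_cst.
  by apply: lipD; apply: lipM => //; exact: lip_tr.
apply: (@ode_unique _ _ (fun t => (X t)^T) X
   (fun t => h (t, (X t)^T)) (fun t => h (t, X t)) C _ _ _ _ t0 t0T) => //.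
  move=> t tT; apply: is_deriv_on_eq (is_deriv_on_tr (hX t tT)) => //.
  by rewrite trmx_riccati.
move=> t tT; have [||_ _] // := hC (t, (X t)^T) (t, X t) `|(X t)^T - X t|.
by split => //=; rewrite ?norm_trmx hr.
Qed.

End RiccatiSymmetry.

(** * Joint state, mean field and their linear coordinates *)

Section Coordinates.
Context {R : realType} {n n1 n2 : nat}.
Variable g : game_data R n n1 n2.
Variable N : nat.

(** The projection of the joint state onto player [j].  All coefficients of the
    games are combinations of these projections and their transposes, so that
    block matrices disappear from the computations that follow. *)
Definition coord (j : 'I_N.+1) : 'M[R]_(n, joint_dim n N) := row_at j 1%:M.

Definition mean_coord : 'M[R]_(n, joint_dim n N) :=
  N%:R^-1 *: \sum_(j < N.+1 | j != ord0) coord j.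

Lemma row_atE j (M : 'M[R]_n) : row_at j M = M *m coord j.
Proof.
rewrite /coord /row_at mul_mxrow; apply: eq_mxrow => k.
by case: eqP; rewrite ?mulmx1 ?mulmx0.
Qed.

Lemma row_minorsE (M : 'M[R]_n) :
  row_minors N M = M *m \sum_(j < N.+1 | j != ord0) coord j.
Proof.
rewrite /row_minors /coord /row_at mulmx_sumr.
under eq_bigr do rewrite mul_mxrow.
rewrite -mxrow_sum; apply: eq_mxrow => k; case: eqP => [->|/eqP k0].
  by rewrite big1// => j j0; rewrite eq_sym (negbTE j0) mulmx0.
rewrite (bigD1 k)//= eqxx mulmx1 big1 ?addr0// => j /andP[_ jk].
by rewrite eq_sym (negbTE jk) mulmx0.
Qed.

Lemma coord_mul_tr i j : coord i *m (coord j)^T = if i == j then 1%:M else 0.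
Proof.
rewrite /coord /row_at tr_mxrow mul_mxrow_mxcol.
rewrite (bigD1 j)//= eqxx trmx1 mulmx1 big1 ?addr0 ?[j == i]eq_sym// => k kj.
by rewrite (negbTE kj) trmx0 mulmx0.
Qed.

Lemma BjointE k :
  Bjoint g k = (coord k)^T *m (if k == ord0 then B_0 g else B_ g).
Proof.
rewrite /Bjoint /coord /row_at tr_mxrow mxcol_mul; apply: eq_mxcol => j.
by case: (j == k); rewrite ?trmx1 ?mul1mx ?trmx0 ?mul0mx.
Qed.

Lemma coord_mxblock j (B : 'I_N.+1 -> 'I_N.+1 -> 'M[R]_n) :
  coord j *m \mxblock_(i, k) B i k = \mxrow_k B j k.
Proof.
rewrite /coord /row_at mul_mxrow_mxblock; apply: eq_mxrow => k.
rewrite (bigD1 j)//= eqxx mul1mx big1 ?addr0// => i ij.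
by rewrite (negbTE ij) mul0mx.
Qed.

Lemma coord_mxdiag j (D : 'I_N.+1 -> 'M[R]_n) :
  coord j *m \mxdiag_i D i = row_at j (D j).
Proof.
rewrite /coord /row_at mul_mxrow_mxdiag; apply: eq_mxrow => k.
by case: eqP => [->|_]; rewrite ?mul1mx ?mul0mx.
Qed.

Lemma row_minorsZ (M : 'M[R]_n) :
  row_minors N (N%:R^-1 *: M) = M *m mean_coord.
Proof. by rewrite row_minorsE -scalemxAl -scalemxAr. Qed.

Lemma coord0_Ahat :
  coord ord0 *m Ahat g N = A_0 g *m coord ord0 + F_0 g *m mean_coord.
Proof.
rewrite /Ahat mulmxDr coord_mxdiag coord_mxblock eqxx row_atE -row_minorsZ.
by congr (_ + _); apply: eq_mxrow => k.
Qed.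

Lemma coord_Ahat j : j != ord0 ->
  coord j *m Ahat g N =
  A_ g *m coord j + (G_ g *m coord ord0 + F_ g *m mean_coord).
Proof.
move=> j0; rewrite /Ahat mulmxDr coord_mxdiag coord_mxblock (negbTE j0) row_atE.
congr (_ + _); rewrite -row_minorsZ -row_atE /row_at /row_minors -mxrowD.
by apply: eq_mxrow => k; case: eqP; rewrite ?addr0 ?add0r.
Qed.

Hypothesis N0 : (0 < N)%N.

Lemma mean_cst p q (M : 'M[R]_(p, q)) :
  N%:R^-1 *: \sum_(j < N.+1 | j != ord0) M = M.
Proof.
rewrite big_mkcond big_ord_recl/= add0r sumr_const card_ord -[M *+ N]scaler_nat.
by rewrite scalerA mulVf ?scale1r// pnatr_eq0 -lt0n.
Qed.

(** The uncontrolled mean field has closed dynamics in the major state and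
    itself; this is why the games reduce to [N]-independent dimensions. *)
Lemma mean_coord_Ahat :
  mean_coord *m Ahat g N = G_ g *m coord ord0 + (A_ g + F_ g) *m mean_coord.
Proof.
rewrite {1}/mean_coord -scalemxAl mulmx_suml.
under eq_bigr => j j0 do rewrite coord_Ahat//.
rewrite big_split/= scalerDr mean_cst -mulmx_sumr scalemxAr -/mean_coord.
by rewrite mulmxDl addrCA.
Qed.

(** The vectors (major state, mean field) and (own state, major state, mean
    field), in the order in which the NCE system lists its blocks. *)
Definition state2 : 'M[R]_(n + n, joint_dim n N) := col_mx (coord ord0) mean_coord.
Definition state3 (i : 'I_N.+1) : 'M[R]_(n + (n + n), joint_dim n N) :=
  col_mx (coord i) state2.

(** A minor player moves the mean field at the rate [1 / N] of its own input:
    [bbB3] is the input matrix of that effect, and [bbB_eps] at [eps = 1 / N] the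
    full input matrix of the player on [state3]. *)
Definition bbB3 : 'M[R]_(n + (n + n), n1) := col_mx 0 (col_mx 0 (B_ g)).
Definition bbB_eps (eps : R) := bbB g + eps *: bbB3.

Lemma K0E : K0 g N = Defs.row0 g *m state2.
Proof.
by rewrite /K0 /Defs.row0 mul_row_col mul1mx mulNmx row_minorsE scalemxAr.
Qed.

Lemma K0fE : K0f g N = row0f g *m state2.
Proof.
by rewrite /K0f /row0f mul_row_col mul1mx mulNmx row_minorsE scalemxAr.
Qed.

Lemma KE i : K g i = Defs.row1 g *m state3 i.
Proof.
rewrite /K /Defs.row1 !mul_row_col mul1mx !mulNmx addrA row_minorsE scalemxAr.
by rewrite !row_atE mul1mx.
Qed.

Lemma KfE i : Kf g i = row1f g *m state3 i.
Proof.
rewrite /Kf /row1f !mul_row_col mul1mx !mulNmx addrA row_minorsE scalemxAr.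
by rewrite !row_atE mul1mx.
Qed.

Lemma mean_coord_tr j :
  mean_coord *m (coord j)^T = if j == ord0 then 0 else (N%:R^-1)%:M.
Proof.
rewrite /mean_coord -scalemxAl mulmx_suml; case: eqP => [->|/eqP j0].
  by rewrite big1 ?scaler0// => k k0; rewrite coord_mul_tr (negbTE k0).
rewrite (bigD1 j)//= coord_mul_tr eqxx big1 ?addr0 ?scalemx1//.
by move=> k /andP[_ kj]; rewrite coord_mul_tr (negbTE kj).
Qed.

Lemma state2_B0 : state2 *m Bjoint g ord0 = bbB0 g.
Proof.
rewrite BjointE/= mulmxA mul_col_mx coord_mul_tr mean_coord_tr !eqxx.
by rewrite mul_col_mx mul1mx mul0mx.
Qed.

Lemma state3_Bi i : i != ord0 -> state3 i *m Bjoint g i = bbB_eps N%:R^-1.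
Proof.
move=> i0; rewrite /state3 /state2 BjointE (negbTE i0) mulmxA !mul_col_mx.
rewrite !coord_mul_tr mean_coord_tr eqxx (negbTE i0) [ord0 == i]eq_sym (negbTE i0).
rewrite !mul1mx mul0mx mul_scalar_mx /bbB_eps /bbB /bbB3 !scale_col_mx !scaler0.
by rewrite !add_col_mx !addr0 -(col_mx0 R n n n1) add_col_mx addr0 add0r.
Qed.

(** Averaging over the players replaces the own state by the mean field.  This
    produces the sums of first and third blocks in [Abar_eps]. *)
Lemma mean_state3 :
  N%:R^-1 *: \sum_(j < N.+1 | j != ord0) state3 j = col_mx mean_coord state2.
Proof.
rewrite (eq_bigr (fun j => col_mx 1%:M 0 *m coord j + col_mx 0 1%:M *m state2)).
  rewrite big_split/= -mulmx_sumr scalerDr mean_cst scalemxAr -/mean_coord.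
  by rewrite !mul_col_mx !mul1mx !mul0mx add_col_mx addr0 add0r.
by move=> j _; rewrite !mul_col_mx !mul1mx !mul0mx add_col_mx addr0 add0r.
Qed.

End Coordinates.

(** * The reduced Riccati system *)

Section ReducedField.
Context {R : realType} {n n1 n2 : nat}.
Variable g : game_data R n n1 n2.
Local Notation dim2 := (n + n)%N.
Local Notation dim3 := (n + (n + n))%N.

(** The feedback gain of a minor player on (own state, major state, mean field)
    in the game with [1 / eps] minor players; [Abar_eps] and [Gbar_eps] are then
    the coefficients of the closed-loop mean field dynamics. *)
Definition minor_gain (eps : R) (L1 : 'M[R]_dim3) : 'M[R]_(n, dim3) :=
  B_ g *m invmx (R_ g) *m (bbB_eps g eps)^T *m L1.

Definition Abar_eps eps L1 : 'M[R]_n :=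
  A_ g + F_ g - lsubmx (minor_gain eps L1) - rsubmx (rsubmx (minor_gain eps L1)).

Definition Gbar_eps eps L1 : 'M[R]_n :=
  G_ g - lsubmx (rsubmx (minor_gain eps L1)).

(** With [b = bbB] and [b' = bbB_eps] this is
    [b R^-1 b'^T + b' R^-1 b^T - b' R^-1 b'^T]: the first two products come from
    the drift under the player's own feedback, the third from the quadratic term
    of its equation.  The sum differs from [b R^-1 b^T] only at second order in
    [eps]. *)
Definition minor_weight (eps : R) : 'M[R]_dim3 :=
  bbB g *m invmx (R_ g) *m (bbB g)^T
  - eps *: (eps *: (bbB3 g *m invmx (R_ g) *m (bbB3 g)^T)).

Definition major_field (eps : R) (L0 : 'M[R]_dim2) (L1 : 'M[R]_dim3) : 'M[R]_dim2 :=
  let A0 := bbA0 g (Abar_eps eps L1) (Gbar_eps eps L1) in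
  discount g *: L0
  - (L0 *m A0 + A0^T *m L0
     - L0 *m (bbB0 g *m invmx (R_0 g) *m (bbB0 g)^T) *m L0 + bbQ0 g).

Definition minor_field (eps : R) (L0 : 'M[R]_dim2) (L1 : 'M[R]_dim3) : 'M[R]_dim3 :=
  let A1 := bbA g L0 (Abar_eps eps L1) (Gbar_eps eps L1) in
  discount g *: L1
  - (L1 *m A1 + A1^T *m L1 - L1 *m minor_weight eps *m L1 + bbQ g).

(** Both unknowns are carried by one block diagonal matrix, so that the theory of
    a single matrix equation applies to the coupled system. *)
Definition reduced_field (eps : R) (Y : 'M[R]_(dim2 + dim3)) : 'M[R]_(dim2 + dim3) :=
  block_mx (major_field eps (ulsubmx Y) (drsubmx Y)) 0
           0 (minor_field eps (ulsubmx Y) (drsubmx Y)).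

Section Lipschitz.
Variable r : R.
Local Notation lip := (bounded_lipschitz (@param_ball R (dim2 + dim3) (dim2 + dim3) r)).

Lemma lip_ulsubmx : lip (fun x => ulsubmx x.2).
Proof. by apply: lip_lsubmx; apply: lip_usubmx; exact: lip_state. Qed.

Lemma lip_drsubmx : lip (fun x => drsubmx x.2).
Proof. by apply: lip_rsubmx; apply: lip_dsubmx; exact: lip_state. Qed.

Lemma lip_minor_gain : lip (fun x => minor_gain x.1 (drsubmx x.2)).
Proof.
apply: lipM; last exact: lip_drsubmx.
apply: lipM; first exact: lip_cst.
by apply: lip_tr; apply: lipD; [|apply: lip_param_scale]; exact: lip_cst.
Qed.

Lemma lip_Abar_eps : lip (fun x => Abar_eps x.1 (drsubmx x.2)).
Proof.
apply: lipB; last by do 2 apply: lip_rsubmx; exact: lip_minor_gain.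
by apply: lipB; [exact: lip_cst|apply: lip_lsubmx; exact: lip_minor_gain].
Qed.

Lemma lip_Gbar_eps : lip (fun x => Gbar_eps x.1 (drsubmx x.2)).
Proof.
by apply: lipB; [exact: lip_cst|apply/lip_lsubmx/lip_rsubmx/lip_minor_gain].
Qed.

Lemma lip_bbA0 : lip (fun x =>
  bbA0 g (Abar_eps x.1 (drsubmx x.2)) (Gbar_eps x.1 (drsubmx x.2))).
Proof.
by apply: lip_block_mx; do ?exact: lip_cst; [exact: lip_Gbar_eps|exact: lip_Abar_eps].
Qed.

Lemma lip_bbA : lip (fun x =>
  bbA g (ulsubmx x.2) (Abar_eps x.1 (drsubmx x.2)) (Gbar_eps x.1 (drsubmx x.2))).
Proof.
apply: lip_block_mx; do ?exact: lip_cst.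
by apply: lipB; [exact: lip_bbA0|apply: lipM; [exact: lip_cst|exact: lip_ulsubmx]].
Qed.

(** The field is polynomial jointly in [eps] and the state.  Hence its Lipschitz
    constants on balls are uniform in [eps], and it converges to the field at
    [eps = 0] at a linear rate. *)
Lemma reduced_field_lip : lip (fun x => reduced_field x.1 x.2).
Proof.
have h0 := lip_ulsubmx; have h1 := lip_drsubmx.
have hA0 := lip_bbA0; have hA := lip_bbA.
apply: lip_block_mx; do ?exact: lip_cst.
  apply: lipB; first exact: lipZ.
  apply: lipD; last exact: lip_cst.
  apply: lipB; last by do ?apply: lipM => //; exact: lip_cst.
  by apply: lipD; apply: lipM => //; exact: lip_tr.
apply: lipB; first exact: lipZ.
apply: lipD; last exact: lip_cst.
apply: lipB.
  by apply: lipD; apply: lipM => //; exact: lip_tr.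
apply: lipM => //; apply: lipM => //.
apply: lipB; first exact: lip_cst.
by do 2 apply: lip_param_scale; exact: lip_cst.
Qed.

End Lipschitz.

End ReducedField.

Section Reduction.
Context {R : realType} {n n1 n2 : nat}.
Variable g : game_data R n n1 n2.
Variable N : nat.
Hypothesis N0 : (0 < N)%N.
Hypothesis (symR0 : (R_0 g)^T = R_0 g) (symR : (R_ g)^T = R_ g).
Local Notation dim2 := (n + n)%N.
Local Notation dim3 := (n + (n + n))%N.
Local Notation eps := (N%:R^-1 : R).
Local Notation e_ := (@coord R n N).
Local Notation xbar := (@mean_coord R n N).
Local Notation S2 := (@state2 R n N).
Local Notation S3 := (@state3 R n N).

(** Value matrices of the players that depend on the joint state only through
    [state2] and [state3]. *)
Definition lifted (L0 : 'M[R]_dim2) (L1 : 'M[R]_dim3) (i : 'I_N.+1) :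
    'M[R]_(joint_dim n N) :=
  if i == ord0 then S2^T *m L0 *m S2 else (S3 i)^T *m L1 *m S3 i.

Variables (L0 : 'M[R]_dim2) (L1 : 'M[R]_dim3).
Hypothesis (symL0 : L0^T = L0) (symL1 : L1^T = L1).
Local Notation P := (lifted L0 L1).

Let H := \sum_(k < N.+1 | k != ord0)
  Bjoint g k *m invmx (R_ g) *m (Bjoint g k)^T *m P k.
Let U := minor_gain g eps L1.

Lemma feedback_sum : H = \sum_(k < N.+1 | k != ord0) (e_ k)^T *m (U *m S3 k).
Proof.
apply: eq_bigr => k k0; rewrite /lifted (negbTE k0) -!mulmxA.
rewrite [(Bjoint g k)^T *m _]mulmxA -trmx_mul state3_Bi// BjointE (negbTE k0).
by rewrite /U /minor_gain !mulmxA.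
Qed.

Lemma coord_feedback j : e_ j *m H = if j == ord0 then 0 else U *m S3 j.
Proof.
rewrite feedback_sum mulmx_sumr; case: eqP => [->|/eqP j0].
  rewrite big1// => k k0; rewrite mulmxA coord_mul_tr eq_sym (negbTE k0).
  by rewrite mul0mx.
rewrite (bigD1 j)//= mulmxA coord_mul_tr eqxx mul1mx big1 ?addr0//.
by move=> k /andP[_ kj]; rewrite mulmxA coord_mul_tr eq_sym (negbTE kj) mul0mx.
Qed.

Lemma mean_feedback : xbar *m H = U *m col_mx xbar S2.
Proof.
rewrite {1}/mean_coord -scalemxAl mulmx_suml.
rewrite (eq_bigr (fun k => U *m S3 k)) => [|k k0]; last first.
  by rewrite coord_feedback (negbTE k0).
by rewrite -mulmx_sumr scalemxAr mean_state3.
Qed.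

Let A0 := bbA0 g (Abar_eps g eps L1) (Gbar_eps g eps L1).

Lemma U_split p (a b c : 'M[R]_(n, p)) :
  U *m col_mx a (col_mx b c) =
  lsubmx U *m a + (lsubmx (rsubmx U) *m b + rsubmx (rsubmx U) *m c).
Proof. by rewrite -{1}[U]hsubmxK -{1}[rsubmx U]hsubmxK !mul_row_col. Qed.

(** Under the feedback of all minor players, (major state, mean field) evolves
    autonomously up to the control of the major player. *)
Lemma state2_closed_loop : S2 *m (Ahat g N - H) = A0 *m S2.
Proof.
rewrite /state2 mul_col_mx !mulmxBr coord_feedback eqxx subr0 coord0_Ahat.
rewrite mean_feedback mean_coord_Ahat// /A0 /bbA0 mul_block_col.
congr (col_mx _ _); rewrite /state2 U_split /Abar_eps /Gbar_eps -/U.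
by rewrite !(mulmxBl, mulmxDl) !opprD; apply/matrixP => i j; rewrite !mxE; ring.
Qed.

Let A1 := bbA g L0 (Abar_eps g eps L1) (Gbar_eps g eps L1).
Let D := Ahat g N - H - Bjoint g ord0 *m invmx (R_0 g) *m (Bjoint g ord0)^T *m P ord0.

Lemma coord_B0 i : i != ord0 -> e_ i *m Bjoint g ord0 = 0.
Proof. by move=> i0; rewrite BjointE mulmxA coord_mul_tr (negbTE i0) mul0mx. Qed.

Lemma B0_P0 : (Bjoint g ord0)^T *m P ord0 = (bbB0 g)^T *m L0 *m S2.
Proof. by rewrite /lifted eqxx !mulmxA -trmx_mul state2_B0. Qed.

(** The dynamics of [state3] when all players, [i] included, use their feedback.
    The matrix [bbB] and not [bbB_eps] multiplies the gain of player [i] since its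
    effect on the mean field is already contained in [Abar_eps] and
    [Gbar_eps]. *)
Lemma state3_closed_loop i : i != ord0 ->
  S3 i *m D = (A1 - bbB g *m (invmx (R_ g) *m (bbB_eps g eps)^T *m L1)) *m S3 i.
Proof.
move=> i0; rewrite /D -[_ *m P ord0]mulmxA B0_P0 {1}/state3 mul_col_mx mulmxBr.
rewrite [S2 *m (_ - _)]mulmxBr !mulmxA coord_B0// state2_B0.
rewrite !mul0mx subr0 mulmxBr coord_feedback (negbTE i0) coord_Ahat//.
have -> : A1 = block_mx (A_ g) (row_mx (G_ g) (F_ g)) 0
    (A0 - bbB0 g *m invmx (R_0 g) *m (bbB0 g)^T *m L0) by [].
rewrite state2_closed_loop; move: A0 (bbB0 g *m _ *m _ *m L0) => a0 z0.
rewrite mulmxBl {2}/state3 mul_block_col mul0mx add0r.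
rewrite /bbB !mul_col_mx !mul0mx opp_col_mx add_col_mx subr0 -mulmxBl.
by congr (col_mx (_ + _ - _) _); rewrite /state2 mul_row_col.
Qed.


Lemma invmx_sym k (M : 'M[R]_k) : M^T = M -> (invmx M)^T = invmx M.
Proof. by move=> h; rewrite trmx_inv h. Qed.

Lemma lifted_sym i : (P i)^T = P i.
Proof.
by rewrite /lifted; case: (i == ord0); rewrite !trmx_mul trmxK ?symL0 ?symL1 mulmxA.
Qed.

Lemma feedback_tr : \sum_(k < N.+1 | k != ord0)
  P k *m Bjoint g k *m invmx (R_ g) *m (Bjoint g k)^T = H^T.
Proof.
rewrite /H linear_sum/=; apply: eq_bigr => k _.
by rewrite !trmx_mul trmxK lifted_sym invmx_sym// !mulmxA.
Qed.

(** An intertwining relation of the dynamics turns into one of the Lyapunov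
    operators. *)
Lemma closed_loop_congr m d (S : 'M[R]_(d, m)) (L Ac : 'M[R]_d) (C : 'M[R]_m) :
  S *m C = Ac *m S -> S^T *m L *m S *m C = S^T *m (L *m Ac) *m S /\
    C^T *m (S^T *m L *m S) = S^T *m (Ac^T *m L) *m S.
Proof.
move=> SC; split; first by rewrite -mulmxA SC !mulmxA.
by rewrite !mulmxA -trmx_mul SC trmx_mul ?mulmxA.
Qed.

(** The shift by half the discount rate on each side adds up to the discount
    term of the reduced equation. *)
Lemma discount_split (X : 'M[R]_(joint_dim n N)) :
  X *m Ahat_rho2 g N + (Ahat_rho2 g N)^T *m X =
  X *m Ahat g N + (Ahat g N)^T *m X - discount g *: X.
Proof.
rewrite /Ahat_rho2 mulmxBr [(_ - _)^T]linearB/= mulmxBl tr_scalar_mx.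
rewrite mul_scalar_mx mul_mx_scalar.
rewrite [in RHS](_ : discount g = discount g / 2 + discount g / 2).
  by rewrite scalerDl opprD addrACA.
by rewrite -mulrDl -mulr2n -[_ *+ 2]mulr_natr mulfK// pnatr_eq0.
Qed.

(** On lifted families the right-hand side of the joint equation is the lift of
    the reduced field: the two terms with the sum over the minor players complete
    the drift to the closed loop of [state2_closed_loop]. *)
Lemma major_rhs_lifted :
  major_rhs g P = S2^T *m major_field g eps L0 L1 *m S2.
Proof.
have [cl1 cl2] := closed_loop_congr L0 state2_closed_loop.
rewrite /major_rhs feedback_tr -/H discount_split.
have quadE : P ord0 *m Bjoint g ord0 *m invmx (R_0 g) *m (Bjoint g ord0)^T *m P ord0
    = S2^T *m (L0 *m (bbB0 g *m invmx (R_0 g) *m (bbB0 g)^T) *m L0) *m S2.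
  rewrite -[LHS]mulmxA B0_P0 /lifted eqxx.
  by rewrite -[S2^T *m L0 *m S2 *m _]mulmxA state2_B0 !mulmxA.
rewrite quadE /major_field -/A0 /Q0joint K0E /lifted eqxx.
set X := S2^T *m L0 *m S2 in cl1 cl2 *.
rewrite mulmxBr in cl1; rewrite [(_ - _)^T]linearB/= mulmxBl in cl2.
rewrite /bbQ0 trmx_mul; set q := (Defs.row0 g)^T *m _ *m _.
have -> : S2^T *m (Defs.row0 g)^T *m Q_0 g *m (Defs.row0 g *m S2) = S2^T *m q *m S2.
  by rewrite /q !mulmxA.
move: cl1 cl2; move: (X *m Ahat g N) (_ *m X) (X *m H) (H^T *m X) => a b c d cl1 cl2.
rewrite !(mulmxBr, mulmxDr) !(mulmxBl, mulmxDl) -cl1 -cl2.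
rewrite -scalemxAr -scalemxAl -/X ?mulmxN ?mulNmx.
move: (S2^T *m _ *m S2) (S2^T *m q *m S2) => e f.
by apply/matrixP => i j; rewrite !mxE; ring.
Qed.

(** The drift, the control of the major player and the sum over all minor players
    form the closed loop of [state3_closed_loop]; the quadratic term then
    corrects for the control of player [i] counted in it. *)
Lemma minor_rhs_lifted i : i != ord0 ->
  minor_rhs g i P = (S3 i)^T *m minor_field g eps L0 L1 *m S3 i.
Proof.
move=> i0.
have [cl1 cl2] := closed_loop_congr L1 (state3_closed_loop i0).
rewrite /minor_rhs feedback_tr -/H discount_split.
have quadE : P i *m Bjoint g i *m invmx (R_ g) *m (Bjoint g i)^T *m P i
    = (S3 i)^T *m (L1 *m (bbB_eps g eps *m invmx (R_ g) *m (bbB_eps g eps)^T)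
                      *m L1) *m S3 i.
  rewrite /lifted (negbTE i0) -[(S3 i)^T *m L1 *m S3 i *m Bjoint g i]mulmxA.
  rewrite state3_Bi// !mulmxA -[_ *m (Bjoint g i)^T *m _]mulmxA -trmx_mul.
  by rewrite state3_Bi// !mulmxA.
have DtrE : D^T = (Ahat g N)^T - H^T
    - P ord0 *m Bjoint g ord0 *m invmx (R_0 g) *m (Bjoint g ord0)^T.
  rewrite /D; move: (lifted_sym ord0); move: H (P ord0) => h0 p0 p0T.
  by rewrite !linearB/= !trmx_mul trmxK p0T invmx_sym// !mulmxA.
rewrite quadE /minor_field -/A1 /Qjoint KE.
have -> : P i = (S3 i)^T *m L1 *m S3 i by rewrite /lifted (negbTE i0).
set X := (S3 i)^T *m L1 *m S3 i in cl1 cl2 *.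
have XE : (S3 i)^T *m (discount g *: L1) *m S3 i = discount g *: X.
  by rewrite -scalemxAr -scalemxAl.
rewrite DtrE in cl2; rewrite /D in cl1; rewrite /bbQ trmx_mul.
set q := (Defs.row1 g)^T *m _ *m _.
have -> : (S3 i)^T *m (Defs.row1 g)^T *m Q_ g *m (Defs.row1 g *m S3 i)
    = (S3 i)^T *m q *m S3 i by rewrite /q !mulmxA.
have trE : (A1 - bbB g *m (invmx (R_ g) *m (bbB_eps g eps)^T *m L1))^T =
    A1^T - L1 *m (bbB_eps g eps *m invmx (R_ g) *m (bbB g)^T).
  by rewrite linearB/= !trmx_mul trmxK symL1 invmx_sym// !mulmxA.
(* The square of bbB_eps - bbB is of second order, whence the expansion. *)
have weightE : minor_weight g eps = bbB g *m invmx (R_ g) *m (bbB_eps g eps)^T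
    + bbB_eps g eps *m invmx (R_ g) *m (bbB g)^T
    - bbB_eps g eps *m invmx (R_ g) *m (bbB_eps g eps)^T.
  rewrite /minor_weight /bbB_eps [(_ + _)^T]linearD/= [(_ *: _)^T]linearZ/=.
  move: (bbB g) (bbB3 g) (invmx (R_ g)) => b c r.
  rewrite !(mulmxDl, mulmxDr) -!(scalemxAl, scalemxAr).
  move: (b *m r *m b^T) (b *m r *m c^T) (c *m r *m b^T) (c *m r *m c^T) => e f h k.
  by apply/matrixP => u v; rewrite !mxE; ring.
rewrite weightE => {weightE quadE DtrE}; move: cl1 cl2; rewrite trE => {trE}.
move: A1 q (bbB_eps g eps) (bbB g) (invmx (R_ g)) XE => a1 q1 be b r XE.
move: X XE H (P ord0) (Ahat g N) (Bjoint g ord0) (invmx (R_0 g)).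
move: (S3 i) => s X XE h p0 a b0 r0.
rewrite !(mulmxBr, mulmxBl, mulmxDr, mulmxDl, mulmxN, mulNmx, mulmxA) => cl1 cl2.
rewrite -[s^T *m (_ *: _) *m s]/(_) XE ?mulmxA.
move: (s^T *m L1 *m b *m r *m be^T *m L1 *m s) (s^T *m L1 *m be *m r *m b^T *m L1 *m s)
  (s^T *m L1 *m be *m r *m be^T *m L1 *m s) (s^T *m q1 *m s) (discount g *: X) cl1 cl2.
move: (X *m a) (X *m h) (X *m b0 *m _ *m _ *m _) (a^T *m X) (h^T *m X).
move: (p0 *m b0 *m _ *m _ *m X) (s^T *m L1 *m a1 *m s) (s^T *m a1^T *m L1 *m s).
move=> x1 x2 x3 x4 x5 x6 x7 x8 y1 y2 y3 y4 y5 c1 c2.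
apply/matrixP => k l; move/matrixP/(_ k l): c1; move/matrixP/(_ k l): c2.
by rewrite !mxE; lra.
Qed.

End Reduction.

(** * Splitting, limit and symmetry of the reduced system *)

Section ReducedSystem.
Context {R : realType} {n n1 n2 : nat}.
Variable g : game_data R n n1 n2.
Local Notation dim2 := (n + n)%N.
Local Notation dim3 := (n + (n + n))%N.
Local Notation T := (horizon g).

Definition reduced_terminal : 'M[R]_(dim2 + dim3) := block_mx (bbQ0f g) 0 0 (bbQf g).

Lemma ode_on_ulsubmx p q (Y h : R -> 'M[R]_(p + q)) :
  ode_on T Y h -> ode_on T (fun t => ulsubmx (Y t)) (fun t => ulsubmx (h t)).
Proof.
move=> hY t tT.
apply: (is_deriv_on_linear (L := fun X => ulsubmx X)) (hY t tT) => a x y.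
by apply/matrixP => i j; rewrite !mxE.
Qed.

Lemma ode_on_drsubmx p q (Y h : R -> 'M[R]_(p + q)) :
  ode_on T Y h -> ode_on T (fun t => drsubmx (Y t)) (fun t => drsubmx (h t)).
Proof.
move=> hY t tT.
apply: (is_deriv_on_linear (L := fun X => drsubmx X)) (hY t tT) => a x y.
by apply/matrixP => i j; rewrite !mxE.
Qed.

Lemma ode_on_block_diag p q (X hX : R -> 'M[R]_p) (Y hY : R -> 'M[R]_q) :
  ode_on T X hX -> ode_on T Y hY ->
  ode_on T (fun t => block_mx (X t) 0 0 (Y t))
           (fun t => block_mx (hX t) 0 0 (hY t)).
Proof.
move=> dX dY t tT.
have E (x : 'M[R]_p) (y : 'M[R]_q) : block_mx x 0 0 y =
    col_mx 1%:M 0 *m x *m row_mx 1%:M 0 + col_mx 0 1%:M *m y *m row_mx 0 1%:M.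
  rewrite !mul_col_mx !mul1mx !mul0mx !mul_mx_row !mulmx1 !mulmx0.
  by rewrite add_col_mx add0r addr0.
have := is_deriv_onD
  (is_deriv_on_mulmx (A := col_mx 1%:M 0) (B := row_mx 1%:M 0) (dX t tT))
  (is_deriv_on_mulmx (A := col_mx 0 1%:M) (B := row_mx 0 1%:M) (dY t tT)).
by apply: is_deriv_on_eq => // [s _|]; rewrite E.
Qed.

Lemma reduced_split (eps : R) Y :
  ode_on T Y (fun t => reduced_field g eps (Y t)) ->
  ode_on T (fun t => ulsubmx (Y t))
    (fun t => major_field g eps (ulsubmx (Y t)) (drsubmx (Y t))) /\
  ode_on T (fun t => drsubmx (Y t))
    (fun t => minor_field g eps (ulsubmx (Y t)) (drsubmx (Y t))).
Proof.
move=> hY; split => t tT.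
  apply: is_deriv_on_eq tT _ _ (ode_on_ulsubmx hY tT) => //.
  by rewrite /reduced_field block_mxKul.
apply: is_deriv_on_eq tT _ _ (ode_on_drsubmx hY tT) => //.
by rewrite /reduced_field block_mxKdr.
Qed.

Lemma reduced_join (eps : R) L0 L1 :
  ode_on T L0 (fun t => major_field g eps (L0 t) (L1 t)) ->
  ode_on T L1 (fun t => minor_field g eps (L0 t) (L1 t)) ->
  ode_on T (fun t => block_mx (L0 t) 0 0 (L1 t))
    (fun t => reduced_field g eps (block_mx (L0 t) 0 0 (L1 t))).
Proof.
move=> h0 h1 t tT; apply: is_deriv_on_eq tT _ _ (ode_on_block_diag h0 h1 tT) => //.
by rewrite /reduced_field block_mxKul block_mxKdr.
Qed.

Lemma bbB_eps0 : bbB_eps g 0 = bbB g.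
Proof. by rewrite /bbB_eps scale0r addr0. Qed.

Lemma minor_gain0 (L1 : 'M[R]_dim3) :
  minor_gain g 0 L1 = B_ g *m invmx (R_ g) *m (B_ g)^T *m usubmx L1.
Proof.
rewrite /minor_gain bbB_eps0 /bbB tr_col_mx trmx0 -{1}[L1]vsubmxK.
by rewrite -[LHS]mulmxA mul_row_col mul0mx addr0 !mulmxA.
Qed.

Lemma Abar_eps0 (L1 : 'M[R]_dim3) : Abar_eps g 0 L1 =
  A_ g + F_ g - B_ g *m invmx (R_ g) *m (B_ g)^T *m blk11 L1
              - B_ g *m invmx (R_ g) *m (B_ g)^T *m blk13 L1.
Proof. by rewrite /Abar_eps minor_gain0 -!(mulmx_lsub, mulmx_rsub). Qed.

Lemma Gbar_eps0 (L1 : 'M[R]_dim3) :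
  Gbar_eps g 0 L1 = G_ g - B_ g *m invmx (R_ g) *m (B_ g)^T *m blk12 L1.
Proof. by rewrite /Gbar_eps minor_gain0 -!(mulmx_lsub, mulmx_rsub). Qed.

Lemma minor_weight0 : minor_weight g 0 = bbB g *m invmx (R_ g) *m (bbB g)^T.
Proof. by rewrite /minor_weight scale0r subr0. Qed.

(** System (i) is the reduced system at [eps = 0], that is, for infinitely many
    players. *)
Lemma nce_system_i_reduced P0 P1 Abar Gbar : nce_system_i g P0 P1 Abar Gbar <->
  [/\ ode_on T P0 (fun t => major_field g 0 (P0 t) (P1 t)) /\ P0 T = bbQ0f g,
      ode_on T P1 (fun t => minor_field g 0 (P0 t) (P1 t)) /\ P1 T = bbQf g,
      forall t : R, 0 <= t <= T -> Abar t = Abar_eps g 0 (P1 t) &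
      forall t : R, 0 <= t <= T -> Gbar t = Gbar_eps g 0 (P1 t)].
Proof.
split=> -[[d0 e0] [d1 e1] hA hG].
  split; [split; last exact: e0|split; last exact: e1| |] => t tT.
  - apply: (is_deriv_on_eq tT _ _ (d0 t tT)) => //.
    by rewrite (hA t tT) (hG t tT) /major_field Abar_eps0 Gbar_eps0 !mulmxA.
  - apply: (is_deriv_on_eq tT _ _ (d1 t tT)) => //.
    rewrite (hA t tT) (hG t tT) /minor_field minor_weight0 Abar_eps0 Gbar_eps0.
    by rewrite !mulmxA.
  - by rewrite Abar_eps0 (hA t tT).
  - by rewrite Gbar_eps0 (hG t tT).
split; [split; last exact: e0|split; last exact: e1| |] => t tT.
- apply: (is_deriv_on_eq tT _ _ (d0 t tT)) => //.
  by rewrite (hA t tT) (hG t tT) /major_field !mulmxA.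
- apply: (is_deriv_on_eq tT _ _ (d1 t tT)) => //.
  by rewrite (hA t tT) (hG t tT) /minor_field minor_weight0 !mulmxA.
- by rewrite (hA t tT) Abar_eps0.
- by rewrite (hG t tT) Gbar_eps0.
Qed.

Hypothesis (symR0 : (R_0 g)^T = R_0 g) (symR : (R_ g)^T = R_ g).
Hypothesis (symQ0 : (Q_0 g)^T = Q_0 g) (symQ : (Q_ g)^T = Q_ g).
Hypothesis (symQ0f : (Q_0f g)^T = Q_0f g) (symQf : (Q_f g)^T = Q_f g).

Lemma congr_sym d m (S : 'M[R]_(d, m)) (M : 'M[R]_d) :
  M^T = M -> (S^T *m M *m S)^T = S^T *m M *m S.
Proof. by move=> h; rewrite !trmx_mul trmxK h mulmxA. Qed.

Lemma congr_sym_tr d m (S : 'M[R]_(m, d)) (M : 'M[R]_d) :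
  M^T = M -> (S *m M *m S^T)^T = S *m M *m S^T.
Proof. by move=> h; rewrite !trmx_mul trmxK h mulmxA. Qed.

Lemma minor_weight_sym eps : (minor_weight g eps)^T = minor_weight g eps.
Proof.
by rewrite /minor_weight linearB !linearZ/= !congr_sym_tr// invmx_sym.
Qed.

Lemma major_field_sym eps L0 L1 :
  L0^T = L0 -> (major_field g eps L0 L1)^T = major_field g eps L0 L1.
Proof.
move=> sL0; rewrite /major_field trmx_riccati ?sL0//.
  exact: congr_sym_tr (invmx_sym symR0).
exact: congr_sym.
Qed.

Lemma minor_field_sym eps L0 L1 :
  L1^T = L1 -> (minor_field g eps L0 L1)^T = minor_field g eps L0 L1.
Proof.
move=> sL1; rewrite /minor_field trmx_riccati ?sL1//.
  exact: minor_weight_sym.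
exact: congr_sym.
Qed.

(** Lifting a solution to the games uses symmetry of both value matrices, which
    holds along the flow by [riccati_symmetric]. *)
Lemma reduced_solution_sym (eps : R) Y : 0 <= eps <= 1 ->
  ode_on T Y (fun t => reduced_field g eps (Y t)) -> Y T = reduced_terminal ->
  forall t : R, 0 <= t <= T ->
    (ulsubmx (Y t))^T = ulsubmx (Y t) /\ (drsubmx (Y t))^T = drsubmx (Y t).
Proof.
move=> eps01 hY YT.
have [r _ hr] := within_cont_bounded (ode_on_continuous hY).
have [h0 h1] := reduced_split hY.
have [a0 ha0] := lip_bounded (lip_bbA0 g r).
have [a1 ha1] := lip_bounded (lip_bbA g r).
have inball (t : R) : 0 <= t <= T -> param_ball r (eps, Y t) (eps, Y t) 0.
  by move=> tT; split; rewrite /= ?subrr ?normr0 ?hr.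
move=> t tT; split.
- apply: (riccati_symmetric _ _ _ h0 _ tT).
  + by move=> s sT; exact: ha0 (inball s sT).
  + exact: congr_sym_tr (invmx_sym symR0).
  + exact: congr_sym.
  + by rewrite YT block_mxKul congr_sym.
- apply: (riccati_symmetric _ _ _ h1 _ tT).
  + by move=> s sT; exact: ha1 (inball s sT).
  + exact: minor_weight_sym.
  + exact: congr_sym.
  + by rewrite YT block_mxKdr congr_sym.
Qed.

End ReducedSystem.

Section EntrywiseNorm.
Context {R : realType}.

Lemma l1norm_ge0 m n (A : 'M[R]_(m, n)) : 0 <= l1norm A.
Proof. by rewrite /l1norm sumr_ge0// => i _; rewrite sumr_ge0. Qed.

Lemma l1normD m n (A B : 'M[R]_(m, n)) : l1norm (A + B) <= l1norm A + l1norm B.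
Proof.
rewrite /l1norm -big_split/=; apply: ler_sum => i _.
by rewrite -big_split/=; apply: ler_sum => j _; rewrite mxE ler_normD.
Qed.

Lemma l1normZ m n a (A : 'M[R]_(m, n)) : l1norm (a *: A) = `|a| * l1norm A.
Proof.
rewrite /l1norm mulr_sumr; apply: eq_bigr => i _.
by rewrite mulr_sumr; apply: eq_bigr => j _; rewrite mxE normrM.
Qed.

Lemma l1norm_tr m n (A : 'M[R]_(m, n)) : l1norm A^T = l1norm A.
Proof.
rewrite /l1norm exchange_big/=; apply: eq_bigr => i _.
by apply: eq_bigr => j _; rewrite mxE.
Qed.

Lemma l1norm_col_mx m m' n (A : 'M[R]_(m, n)) (B : 'M[R]_(m', n)) :
  l1norm (col_mx A B) = l1norm A + l1norm B.
Proof.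
rewrite /l1norm big_split_ord/=; congr (_ + _); apply: eq_bigr => i _;
by apply: eq_bigr => j _; rewrite ?col_mxEu ?col_mxEd.
Qed.

(** The sum of absolute values of the entries is submultiplicative, with no
    dependence on dimensions: this keeps bounds uniform in the number of players. *)
Lemma l1norm_mulmx m k n (A : 'M[R]_(m, k)) (B : 'M[R]_(k, n)) :
  l1norm (A *m B) <= l1norm A * l1norm B.
Proof.
rewrite /l1norm mulr_suml; apply: ler_sum => i _.
rewrite mulr_suml.
apply: (@le_trans _ _ (\sum_j \sum_l `|A i l| * `|B l j|)).
  apply: ler_sum => j _; rewrite mxE; apply: le_trans (ler_norm_sum _ _ _) _.
  by apply: ler_sum => l _; rewrite normrM.
rewrite exchange_big/=; apply: ler_sum => l _.
rewrite -mulr_sumr ler_wpM2l// [leRHS](bigD1 l)//= lerDl sumr_ge0// => a _.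
by rewrite sumr_ge0.
Qed.

Lemma l1norm_le m n (A : 'M[R]_(m, n)) : l1norm A <= (m * n)%:R * `|A|.
Proof.
rewrite /l1norm natrM -mulrA.
apply: (@le_trans _ _ (\sum_(i < m) n%:R * `|A|)).
  apply: ler_sum => i _; rewrite mulr_natl -[X in _ *+ X]card_ord -sumr_const.
  by apply: ler_sum => j _; exact: ler_mx_entry.
by rewrite sumr_const card_ord [leRHS]mulr_natl.
Qed.

(** Each entry of [A *m P *m B] is a combination of the entries of [P] with
    coefficients at most [`|A| * `|B|]; hence a bound free of the dimension of
    [P]. *)
Lemma norm_congr_le_l1norm m p q n (A : 'M[R]_(m, p)) (P : 'M[R]_(p, q))
    (B : 'M[R]_(q, n)) : `|A *m P *m B| <= `|A| * `|B| * l1norm P.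
Proof.
apply/mx_norm_leP => [|i j]; first by rewrite !mulr_ge0// l1norm_ge0.
rewrite mxE /l1norm exchange_big/= mulr_sumr.
apply: le_trans (ler_norm_sum _ _ _) _; apply: ler_sum => l _.
rewrite mxE mulr_suml mulr_sumr; apply: le_trans (ler_norm_sum _ _ _) _.
apply: ler_sum => k _; rewrite !normrM mulrAC ler_wpM2r//.
by rewrite ler_pM// ler_mx_entry.
Qed.

End EntrywiseNorm.

(** * From the NCE system to asymptotic solvability *)

Section LiftedNorm.
Context {R : realType} {n n1 n2 : nat}.
Variable N : nat.

Lemma l1norm_coord (j : 'I_N.+1) : l1norm (@coord R n N j) = n%:R.
Proof.
have rowE a : \sum_k `|@coord R n N j a k| = 1.
  have <- : (coord j *m (const_mx 1 : 'cV[R]_(joint_dim n N))) a 0 = 1.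
    rewrite -(mxcol_const (p_ := fun _ : 'I_N.+1 => n)) /coord /row_at.
    rewrite mul_mxrow_mxcol (bigD1 j)//= eqxx mul1mx big1 ?addr0 ?mxE// => k kj.
    by rewrite (negbTE kj) mul0mx.
  rewrite [RHS]mxE; apply: eq_bigr => k _.
  rewrite [const_mx 1 k 0]mxE mulr1 ger0_norm// /coord /row_at mxE.
  by case: ifP; rewrite !mxE.
rewrite /l1norm; under eq_bigr do rewrite rowE.
by rewrite sumr_const card_ord.
Qed.

Hypothesis N0 : (0 < N)%N.

(** The [N] blocks of the mean field are compensated by the factor [1 / N]. *)
Lemma l1norm_mean_coord : l1norm (@mean_coord R n N) <= n%:R.
Proof.
rewrite /mean_coord l1normZ ger0_norm ?invr_ge0//.
rewrite mulrC ler_pdivrMr ?ltr0n//.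
apply: (@le_trans _ _ (\sum_(j < N.+1 | j != ord0) l1norm (@coord R n N j))).
  apply: (big_ind2 (fun A b => l1norm A <= b)) => //.
    by rewrite /l1norm big1// => i _; rewrite big1// => j _; rewrite mxE normr0.
  by move=> A a B b Aa Bb; apply: le_trans (l1normD _ _) _; rewrite lerD.
under eq_bigr do rewrite l1norm_coord.
by rewrite big_mkcond big_ord_recl/= add0r sumr_const card_ord mulr_natr.
Qed.

Lemma l1norm_state2 : l1norm (@state2 R n N) <= n%:R + n%:R.
Proof. by rewrite /state2 l1norm_col_mx l1norm_coord lerD2l l1norm_mean_coord. Qed.

Lemma l1norm_state3 i : l1norm (@state3 R n N i) <= n%:R + (n%:R + n%:R).
Proof. by rewrite /state3 l1norm_col_mx l1norm_coord lerD2l l1norm_state2. Qed.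

Lemma l1norm_congr d m (S : 'M[R]_(d, m)) (L : 'M[R]_d) (c : R) :
  l1norm S <= c -> l1norm (S^T *m L *m S) <= c * ((d * d)%:R * `|L|) * c.
Proof.
move=> Sc; have c0 := le_trans (l1norm_ge0 S) Sc.
apply: le_trans (l1norm_mulmx _ _) _; apply: ler_pM => //; try exact: l1norm_ge0.
apply: le_trans (l1norm_mulmx _ _) _; apply: ler_pM => //; try exact: l1norm_ge0.
  by rewrite l1norm_tr.
exact: l1norm_le.
Qed.

End LiftedNorm.

Section NCEToGames.
Context {R : realType} {n n1 n2 : nat}.
Variable g : game_data R n n1 n2.
Hypothesis (T0 : 0 < horizon g).
Hypothesis (symR0 : (R_0 g)^T = R_0 g) (symR : (R_ g)^T = R_ g).
Hypothesis (symQ0 : (Q_0 g)^T = Q_0 g) (symQ : (Q_ g)^T = Q_ g).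
Hypothesis (symQ0f : (Q_0f g)^T = Q_0f g) (symQf : (Q_f g)^T = Q_f g).
Local Notation dim2 := (n + n)%N.
Local Notation dim3 := (n + (n + n))%N.
Local Notation T := (horizon g).

Lemma Q0fjointE N : Q0fjoint g N = (state2 N)^T *m bbQ0f g *m state2 N.
Proof. by rewrite /Q0fjoint K0fE trmx_mul !mulmxA. Qed.

Lemma QfjointE N (i : 'I_N.+1) : Qfjoint g i = (state3 i)^T *m bbQf g *m state3 i.
Proof. by rewrite /Qfjoint KfE trmx_mul !mulmxA. Qed.

Lemma lifted_riccati_solution N Y : (0 < N)%N ->
  ode_on T Y (fun t => reduced_field g (N%:R^-1) (Y t)) -> Y T = reduced_terminal g ->
  riccati_solution g (fun (i : 'I_N.+1) t =>
    lifted (ulsubmx (Y t)) (drsubmx (Y t)) i).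
Proof.
move=> N0 hY YT.
have eps01 : 0 <= (N%:R^-1 : R) <= 1.
  by rewrite invr_ge0 ler0n invf_le1 ?ltr0n ?ler1n.
have hsym := reduced_solution_sym symR0 symR symQ0 symQ symQ0f symQf eps01 hY YT.
have [h0 h1] := reduced_split hY.
split.
- move=> t tT; have [s0 s1] := hsym t tT.
  have := is_deriv_on_mulmx (A := (state2 N)^T) (B := state2 N) (h0 t tT).
  apply: is_deriv_on_eq => //.
  by rewrite -major_rhs_lifted.
- by rewrite /lifted eqxx YT block_mxKul Q0fjointE.
- move=> i i0 t tT; have [s0 s1] := hsym t tT.
  have := is_deriv_on_mulmx (A := (state3 i)^T) (B := state3 i) (h1 t tT).
  apply: is_deriv_on_eq => // [s _|]; first by rewrite /lifted (negbTE i0).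
  by rewrite -minor_rhs_lifted.
- by move=> i i0; rewrite /lifted (negbTE i0) YT block_mxKdr QfjointE.
Qed.

Lemma inv_nat_small (d : R) : 0 < d -> exists N0 : nat,
  (0 < N0)%N /\ forall N : nat, (N0 <= N)%N -> N%:R^-1 <= d.
Proof.
move=> d0; exists (Num.bound d^-1).+1; split => // N hN.
rewrite invf_ple ?posrE//; last by rewrite ltr0n (leq_trans _ hN).
apply: le_trans (ltW (archi_boundP _)) _; first by rewrite invr_ge0 ltW.
by rewrite ler_nat (leq_trans _ hN).
Qed.

Lemma asymptotic_of_reduced (r d : R) : 0 < d ->
  (forall e, 0 <= e <= d -> exists Y,
    [/\ ode_on T Y (fun t => reduced_field g e (Y t)), Y T = reduced_terminal g &
        forall t : R, 0 <= t <= T -> `|Y t| <= r]) ->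
  asymptotic_solvability g.
Proof.
move=> d0 hY; have [N0 [N0gt0 hN0]] := inv_nat_small d0.
have /choice[Y hYN] (N : nat) : exists Y, (N0 <= N)%N ->
   [/\ ode_on T Y (fun t => reduced_field g (N%:R^-1) (Y t)), Y T = reduced_terminal g &
        forall t : R, 0 <= t <= T -> `|Y t| <= r].
  have [hN|hN] := boolP (N0 <= N)%N; last by exists (fun=> 0).
  have [|Y hY'] := hY N%:R^-1; last by exists Y.
  by rewrite invr_ge0 ler0n hN0.
exists N0, (fun N i t => lifted (ulsubmx (Y N t)) (drsubmx (Y N t)) i); split => //.
  move=> N hN; have [h1 h2 _] := hYN N hN.
  by apply: lifted_riccati_solution => //; exact: leq_trans hN.
pose c2 : R := n%:R + n%:R; pose c3 : R := n%:R + (n%:R + n%:R).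
exists (c2 * ((dim2 * dim2)%:R * r) * c2 + c3 * ((dim3 * dim3)%:R * r) * c3).
move=> x [N [t [hN tT ->]]].
have N1 : (0 < N)%N := leq_trans N0gt0 hN.
have [_ _ hr] := hYN N hN.
have i0 : (inord 1 : 'I_N.+1) != ord0 by rewrite -val_eqE/= inordK.
rewrite /lifted eqxx (negbTE i0).
have hul : `|ulsubmx (Y N t)| <= r.
  apply/mx_norm_leP => [|i j]; first exact: le_trans (normr_ge0 _) (hr t tT).
  by rewrite !mxE; apply: le_trans (ler_mx_entry _ _ _) (hr t tT).
have hdr : `|drsubmx (Y N t)| <= r.
  apply/mx_norm_leP => [|i j]; first exact: le_trans (normr_ge0 _) (hr t tT).
  by rewrite !mxE; apply: le_trans (ler_mx_entry _ _ _) (hr t tT).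
apply: lerD.
  have h := l1norm_congr (ulsubmx (Y N t)) (l1norm_state2 N1). apply: le_trans h _.
  by rewrite ler_wpM2r ?addr_ge0// ler_wpM2l ?addr_ge0// ler_wpM2l.
have h := l1norm_congr (drsubmx (Y N t)) (l1norm_state3 N1 (inord 1)).
apply: le_trans h _.
by rewrite ler_wpM2r ?addr_ge0// ler_wpM2l ?addr_ge0// ler_wpM2l.
Qed.

Theorem nce_asymptotic : nce_solvable g -> asymptotic_solvability g.
Proof.
move=> [P0 [P1 [Abar [Gbar [s0 [s1 [mbar [_ _ hi _]]]]]]]].
have [[d0 e0] [d1 e1] _ _] := (nce_system_i_reduced _ _ _ _ _).1 hi.
have yT : block_mx (P0 T) 0 0 (P1 T) = reduced_terminal g by rewrite e0 e1.
have [r [d dgt0 hd]] := perturbed_solution (ltW T0) (reduced_field_lip g)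
  (reduced_join d0 d1) yT.
exact: asymptotic_of_reduced dgt0 hd.
Qed.

End NCEToGames.

(** * Lifting reduced states back to joint states *)

Section RightInverses.
Context {R : realType} {n : nat}.
Variable N : nat.
Local Notation e_ := (@coord R n N).
Local Notation xbar := (@mean_coord R n N).

(** A joint state with prescribed (major state, mean field): all minor players sit
    at the mean. *)
Definition state2_inv : 'M[R]_(joint_dim n N, n + n) :=
  row_mx (e_ ord0)^T (row_minors N 1%:M)^T.

(** A unit displacement spread over the minor players other than [i]. *)
Definition others_mean (i : 'I_N.+1) : 'M[R]_(joint_dim n N, n) :=
  N.-1%:R^-1 *: ((row_minors N 1%:M)^T - (e_ i)^T).

(** A joint state with prescribed (own state, major state, mean field): the other
    minor players share one position, chosen to produce the mean.  Sharing
    the compensation, rather than loading it on one player, keeps the entries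
    bounded as [N] grows. *)
Definition state3_inv (i : 'I_N.+1) : 'M[R]_(joint_dim n N, n + (n + n)) :=
  row_mx ((e_ i)^T - others_mean i) (row_mx (e_ ord0)^T (N%:R *: others_mean i)).

Hypothesis N1 : (1 < N)%N.

Lemma coord_minors j : e_ j *m (row_minors N 1%:M)^T = if j == ord0 then 0 else 1%:M.
Proof.
rewrite row_minorsE mul1mx linear_sum mulmx_sumr/=; case: eqP => [->|/eqP j0].
  by rewrite big1// => k k0; rewrite coord_mul_tr eq_sym (negbTE k0).
rewrite (bigD1 j)//= coord_mul_tr eqxx big1 ?addr0// => k /andP[_ kj].
by rewrite coord_mul_tr eq_sym (negbTE kj).
Qed.

Lemma mean_minors : xbar *m (row_minors N 1%:M)^T = 1%:M.
Proof.
rewrite /mean_coord -scalemxAl mulmx_suml -[RHS](@mean_cst R N (ltnW N1)).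
by congr (_ *: _); apply: eq_bigr => j j0; rewrite coord_minors (negbTE j0).
Qed.

Lemma state2_invK : state2 N *m state2_inv = 1%:M.
Proof.
rewrite /state2 /state2_inv mul_col_row coord_mul_tr mean_coord_tr coord_minors.
by rewrite mean_minors !eqxx scalar_mx_block.
Qed.

Let N1neq0 : N.-1%:R != 0 :> R.
Proof. by rewrite pnatr_eq0; case: N N1 => [|[]]. Qed.

Lemma state3_invK i : i != ord0 -> state3 i *m state3_inv i = 1%:M.
Proof.
move=> i0.
have w0 : e_ ord0 *m others_mean i = 0.
  rewrite /others_mean -scalemxAr mulmxBr coord_minors eqxx coord_mul_tr.
  by rewrite eq_sym (negbTE i0) subr0 scaler0.
have wi : e_ i *m others_mean i = 0.
  rewrite /others_mean -scalemxAr mulmxBr coord_minors (negbTE i0) coord_mul_tr.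
  by rewrite eqxx subrr scaler0.
have wm : xbar *m others_mean i = (N%:R^-1)%:M.
  rewrite /others_mean -scalemxAr mulmxBr mean_minors mean_coord_tr (negbTE i0).
  rewrite -raddfB scale_scalar_mx; congr _%:M.
  have NE : N%:R = N.-1%:R + 1 :> R by rewrite natr1 prednK// ltnW.
  have N0 : N.-1%:R + 1 != 0 :> R by rewrite -NE pnatr_eq0 -lt0n ltnW.
  by rewrite NE; field; rewrite N0 N1neq0.
rewrite /state3 /state3_inv mul_col_row mulmxBr coord_mul_tr eqxx wi subr0.
rewrite mul_mx_row coord_mul_tr (negbTE i0) -scalemxAr wi scaler0 row_mx0.
rewrite /state2 mul_col_row mul_col_mx !mulmxBr !coord_mul_tr.
rewrite [ord0 == i]eq_sym (negbTE i0) w0 subr0 !mean_coord_tr (negbTE i0) wm subrr.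
rewrite col_mx0 !eqxx -[e_ ord0 *m (_ *: _)]scalemxAr w0 scaler0.
rewrite -[xbar *m (_ *: _)]scalemxAr wm.
rewrite scale_scalar_mx divff ?pnatr_eq0 -?lt0n 1?ltnW//.
by rewrite -scalar_mx_block -scalar_mx_block.
Qed.

Lemma norm_coord_tr i : `|(e_ i)^T| <= 1.
Proof.
rewrite norm_trmx; apply/mx_norm_leP => // a b; rewrite /coord /row_at mxE.
case: ifP => _; rewrite !mxE ?normr0//.
by case: (_ == _); rewrite ?normr1 ?normr0.
Qed.

Lemma norm_minors_tr : `|(row_minors N (1%:M : 'M[R]_n))^T| <= 1.
Proof.
rewrite norm_trmx; apply/mx_norm_leP => // a b; rewrite /row_minors mxE.
case: ifP => _; rewrite !mxE ?normr0//.
by case: (_ == _); rewrite ?normr1 ?normr0.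
Qed.

Lemma norm_row_mx_le p q q' (A : 'M[R]_(p, q)) (B : 'M[R]_(p, q')) c :
  `|A| <= c -> `|B| <= c -> `|row_mx A B| <= c.
Proof.
move=> Ac Bc; apply/mx_norm_leP => [|i j]; first exact: le_trans Ac.
by rewrite mxE; case: (fintype.split j) => k; apply: le_trans (ler_mx_entry _ _ _) _.
Qed.

Lemma norm_col_mx_le p p' q (A : 'M[R]_(p, q)) (B : 'M[R]_(p', q)) c :
  `|A| <= c -> `|B| <= c -> `|col_mx A B| <= c.
Proof.
move=> Ac Bc; rewrite -norm_trmx tr_col_mx.
by apply: norm_row_mx_le; rewrite norm_trmx.
Qed.

Lemma norm_state2_inv : `|state2_inv| <= 1.
Proof. exact: norm_row_mx_le (norm_coord_tr _) norm_minors_tr. Qed.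

(** The bound comes from [N / (N - 1) <= 2]. *)
Lemma norm_state3_inv i : `|state3_inv i| <= 4.
Proof.
have N1R : 1 <= N.-1%:R :> R by rewrite ler1n; case: N N1 => [|[]].
have hw : `|(row_minors N 1%:M)^T - (e_ i)^T| <= 2.
  apply: le_trans (ler_normB _ _) _.
  by apply: le_trans (lerD norm_minors_tr (norm_coord_tr i)) _; lra.
have w2 : `|others_mean i| <= 2.
  rewrite /others_mean normrZ normfV ger0_norm// mulrC.
  rewrite ler_pdivrMr ?(lt_le_trans ltr01)//.
  by apply: le_trans hw _; rewrite ler_peMr.
apply: norm_row_mx_le.
  apply: le_trans (ler_normB _ _) _.
  by apply: le_trans (lerD (norm_coord_tr i) w2) _; lra.
apply: norm_row_mx_le; first by apply: le_trans (norm_coord_tr _) _; rewrite ler1n.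
rewrite /others_mean scalerA normrZ.
have -> : `|N%:R / N.-1%:R : R| = N%:R / N.-1%:R by rewrite ger0_norm// divr_ge0.
have NE : N%:R = N.-1%:R + 1 :> R by rewrite natr1 prednK// ltnW.
have h2 : N%:R / N.-1%:R <= 2 :> R.
  by rewrite ler_pdivrMr ?(lt_le_trans ltr01)// NE; lra.
have -> : (4 : R) = 2 * 2 by ring.
by rewrite ler_pM// divr_ge0.
Qed.

End RightInverses.

(** * From asymptotic solvability to the reduced limit system *)

Section Symmetrization.
Context {R : realType}.

Definition sym_part d (X : 'M[R]_d) : 'M[R]_d := 2^-1 *: (X + X^T).

Lemma sym_part_tr d (X : 'M[R]_d) : (sym_part X)^T = sym_part X.
Proof. by rewrite /sym_part linearZ/= linearD/= trmxK addrC. Qed.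

Lemma sym_part_id d (X : 'M[R]_d) : X^T = X -> sym_part X = X.
Proof.
move=> XT; rewrite /sym_part XT -mulr2n -[X *+ 2]scaler_nat scalerA.
by rewrite mulVf ?scale1r ?pnatr_eq0.
Qed.

Lemma sym_part_linear d : linear (@sym_part d).
Proof. by move=> a x y; apply/matrixP => i j; rewrite !mxE; ring. Qed.

Lemma norm_sym_part d (X : 'M[R]_d) : `|sym_part X| <= `|X|.
Proof.
rewrite /sym_part normrZ ger0_norm ?invr_ge0// mulrC ler_pdivrMr//.
by apply: le_trans (ler_normD _ _) _; rewrite norm_trmx; lra.
Qed.

(** A left inverse of the congruence [L |-> S^T *m L *m S] on symmetric matrices
    when [S *m E = 1].  Taking the symmetric part makes the reduced matrices
    symmetric by construction; the symmetry of a joint solution then comes out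
    of the same uniqueness argument as its being a lift. *)
Definition compress d m (E : 'M[R]_(m, d)) (X : 'M[R]_m) : 'M[R]_d :=
  sym_part (E^T *m X *m E).

Lemma compress_linear d m (E : 'M[R]_(m, d)) : linear (compress E).
Proof.
move=> a x y; rewrite /compress mulmxDr mulmxDl -scalemxAr -scalemxAl.
exact: sym_part_linear.
Qed.

Lemma compressK d m (S : 'M[R]_(d, m)) (E : 'M[R]_(m, d)) (L : 'M[R]_d) :
  S *m E = 1%:M -> L^T = L -> compress E (S^T *m L *m S) = L.
Proof.
move=> SE LT; rewrite /compress !mulmxA -trmx_mul SE trmx1 mul1mx.
by rewrite -mulmxA SE mulmx1 sym_part_id.
Qed.

Lemma norm_compress d m (E : 'M[R]_(m, d)) (X : 'M[R]_m) :
  `|compress E X| <= `|E| * `|E| * l1norm X.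
Proof.
apply: le_trans (norm_sym_part _) _; apply: le_trans (norm_congr_le_l1norm _ _ _) _.
by rewrite norm_trmx.
Qed.

End Symmetrization.

Section MxrowNorm.
Context {R : realType}.
Variables (m d : nat).

Lemma norm_mxrow_le k (B : 'I_k -> 'M[R]_(m, d)) (c : R) : 0 <= c ->
  (forall j, `|B j| <= c) -> `|\mxrow_j B j| <= c.
Proof.
move=> c0 hB; apply/mx_norm_leP => // i j; rewrite mxE.
by apply: le_trans (ler_mx_entry _ _ _) (hB _).
Qed.

Lemma norm_le_mxrow k (B : 'I_k -> 'M[R]_(m, d)) j : `|B j| <= `|\mxrow_j B j|.
Proof.
apply/mx_norm_leP => // i l.
rewrite -[B j](mxrowK B j) mxE; exact: ler_mx_entry.
Qed.

Lemma ode_on_mxrow T k (B hB : 'I_k -> R -> 'M[R]_(m, d)) :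
  (forall j, ode_on T (B j) (hB j)) ->
  ode_on T (fun t => \mxrow_j B j t) (fun t => \mxrow_j hB j t).
Proof.
move=> h t tT; apply/is_deriv_on_entries => i j.
have /is_deriv_on_entries/(_ i (tagnat.sig2 j)) := h (tagnat.sig1 j) t tT.
by apply: is_deriv_on_eq => // [s _|]; rewrite !mxE.
Qed.

End MxrowNorm.

Section GamesToNCE.
Context {R : realType} {n n1 n2 : nat}.
Variable g : game_data R n n1 n2.
Hypothesis (T0 : 0 < horizon g).
Hypothesis (symR0 : (R_0 g)^T = R_0 g) (symR : (R_ g)^T = R_ g).
Hypothesis (symQ0 : (Q_0 g)^T = Q_0 g) (symQ : (Q_ g)^T = Q_ g).
Hypothesis (symQ0f : (Q_0f g)^T = Q_0f g) (symQf : (Q_f g)^T = Q_f g).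
Local Notation dim2 := (n + n)%N.
Local Notation dim3 := (n + (n + n))%N.
Local Notation T := (horizon g).

Section FixedN.
Variable N : nat.
Hypothesis N1 : (1 < N)%N.
Let N0 : (0 < N)%N := ltnW N1.
Local Notation i1 := (inord 1 : 'I_N.+1).
Local Notation family := ('I_N.+1 -> 'M[R]_(joint_dim n N)).

Let i1neq0 : i1 != ord0. Proof. by rewrite -val_eqE/= inordK// ltnS. Qed.

Definition riccati_rhs (P : family) (i : 'I_N.+1) : 'M[R]_(joint_dim n N) :=
  if i == ord0 then major_rhs g P else minor_rhs g i P.

Definition family_ball (r : R) (P P' : family) (d : R) : Prop :=
  [/\ forall i, `|P i| <= r, forall i, `|P' i| <= r & forall i, `|P i - P' i| <= d].

Lemma lip_family r i : bounded_lipschitz (family_ball r) (fun P => P i).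
Proof.
exists (`|r| + 1); first by rewrite addr_ge0.
have r1 : r <= `|r| + 1 by rewrite (le_trans (ler_norm _))// lerDl.
move=> x y d [xr yr xyd] d0; split; try exact: le_trans r1.
by rewrite (le_trans (xyd i))// ler_peMl// lerDr.
Qed.

(** The constant depends on [N]; it only serves uniqueness at a fixed [N]. *)
Lemma lip_riccati_rhs r i : bounded_lipschitz (family_ball r) (riccati_rhs ^~ i).
Proof.
have hP := lip_family r.
have cst p q (A : 'M[R]_(p, q)) := lip_cst (family_ball r) A.
have hs1 : bounded_lipschitz (family_ball r) (fun P => \sum_(k < N.+1 | k != ord0)
    Bjoint g k *m invmx (R_ g) *m (Bjoint g k)^T *m P k).
  by apply: lip_sum => k _; apply: lipM; [exact: cst|exact: hP].
have hs2 : bounded_lipschitz (family_ball r) (fun P => \sum_(k < N.+1 | k != ord0)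
    P k *m Bjoint g k *m invmx (R_ g) *m (Bjoint g k)^T).
  by apply: lip_sum => k _; do 3 (apply: lipM; last exact: cst); exact: hP.
have hsum k : bounded_lipschitz (family_ball r) (fun P =>
    P k *m (\sum_(k < N.+1 | k != ord0)
      Bjoint g k *m invmx (R_ g) *m (Bjoint g k)^T *m P k)).
  by apply: lipM; [exact: hP|exact: hs1].
have hsum' k : bounded_lipschitz (family_ball r) (fun P =>
    (\sum_(k < N.+1 | k != ord0)
      P k *m Bjoint g k *m invmx (R_ g) *m (Bjoint g k)^T) *m P k).
  by apply: lipM; [exact: hs2|exact: hP].
have hdrift k : bounded_lipschitz (family_ball r) (fun P =>
    - (P k *m Ahat_rho2 g N + (Ahat_rho2 g N)^T *m P k)).
  apply: lipN; apply: lipD; apply: lipM; by [exact: cst|exact: hP].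
have hquad k l m (M : 'M[R]_n1) : bounded_lipschitz (family_ball r) (fun P =>
    P k *m Bjoint g l *m M *m (Bjoint g l)^T *m P m).
  by apply: lipM; [do 3 (apply: lipM; last exact: cst); exact: hP|exact: hP].
rewrite /riccati_rhs; case: (i == ord0).
  apply: lipB; last exact: cst.
  apply: lipD; last exact: hsum'.
  apply: lipD; last exact: hsum.
  by apply: lipD; [exact: hdrift|exact: hquad].
apply: lipB; last exact: cst.
apply: lipD; last by apply: lipD; [exact: hsum|exact: hsum'].
apply: lipD; last by apply: lipD; exact: hquad.
by apply: lipB; [exact: hdrift|exact: hquad].
Qed.

(** The reduced matrices are read off the major player and the minor player of
    index 1, the two players that asymptotic solvability bounds. *)
Definition compress0 := compress (@state2_inv R n N).
Definition compress1 := compress (@state3_inv R n N i1).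

Variables (P : 'I_N.+1 -> R -> 'M[R]_(joint_dim n N)).
Hypothesis hP : riccati_solution g P.

Let L0 t := compress0 (P ord0 t).
Let L1 t := compress1 (P i1 t).

Let odeP i : ode_on T (P i) (fun t => riccati_rhs (P ^~ t) i).
Proof.
case: hP => h0 _ h1 _; rewrite /riccati_rhs.
have [->|i0] := eqVneq i ord0; first exact: h0.
exact: h1.
Qed.

(** Lifted families are invariant under the field: projecting the field back to
    lifted families does nothing there. *)
Lemma lifted_rhs t (i : 'I_N.+1) :
  riccati_rhs (lifted (L0 t) (L1 t)) i =
  lifted (compress0 (riccati_rhs (lifted (L0 t) (L1 t)) ord0))
         (compress1 (riccati_rhs (lifted (L0 t) (L1 t)) i1)) i.
Proof.
have s0 : (L0 t)^T = L0 t by exact: sym_part_tr.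
have s1 : (L1 t)^T = L1 t by exact: sym_part_tr.
rewrite /riccati_rhs eqxx (negbTE i1neq0) major_rhs_lifted//.
rewrite [minor_rhs g i1 _]minor_rhs_lifted// /compress0 /compress1.
rewrite !compressK ?state2_invK ?state3_invK ?major_field_sym ?minor_field_sym//.
rewrite [RHS]/lifted; have [//|i0] := boolP (i == ord0).
by rewrite minor_rhs_lifted.
Qed.

Lemma ode_on_lifted (i : 'I_N.+1) : ode_on T (fun t => lifted (L0 t) (L1 t) i)
  (fun t => lifted (compress0 (riccati_rhs (P ^~ t) ord0))
                   (compress1 (riccati_rhs (P ^~ t) i1)) i).
Proof.
move=> t tT.
have h0 := is_deriv_on_linear (compress_linear (@state2_inv R n N)) (@odeP ord0 t tT).
have h1 := is_deriv_on_linear (compress_linear (@state3_inv R n N i1)) (@odeP i1 t tT).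
rewrite /lifted; case: (i == ord0).
  exact: is_deriv_on_mulmx h0.
exact: is_deriv_on_mulmx h1.
Qed.

(** Exchangeability of the minor players and symmetry of the value matrices both
    follow from uniqueness.  The projection of the solution onto lifted
    families follows the projected field.  On lifted families the field and its
    projection agree by [lifted_rhs], so the difference of the two
    derivatives is Lipschitz in the defect, and the defect vanishes at the
    terminal time. *)
Lemma riccati_solution_lifted (t : R) : 0 <= t <= T ->
  forall i, P i t = lifted (L0 t) (L1 t) i.
Proof.
move=> tT.
(* All players are put side by side to apply uniqueness for one equation. *)
pose Z t := \mxrow_i P i t; pose W t := \mxrow_(i < N.+1) lifted (L0 t) (L1 t) i.
have dZ := ode_on_mxrow odeP.
have dW := ode_on_mxrow ode_on_lifted.
have [rZ rZ0 hrZ] := within_cont_bounded (ode_on_continuous dZ).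
have [rW rW0 hrW] := within_cont_bounded (ode_on_continuous dW).
pose r := rZ + rW.
have lip_defect : forall i, bounded_lipschitz (family_ball r) (fun Q => riccati_rhs Q i
  - lifted (compress0 (riccati_rhs Q ord0)) (compress1 (riccati_rhs Q i1)) i).
  move=> i; apply: lipB; first exact: lip_riccati_rhs.
  rewrite /lifted; case: (i == ord0).
    apply: lipM; last exact: lip_cst.
    apply: lipM; first exact: lip_cst.
    exact: lip_linear (compress_linear _) (lip_riccati_rhs _ _).
  apply: lipM; last exact: lip_cst.
  apply: lipM; first exact: lip_cst.
  exact: lip_linear (compress_linear _) (lip_riccati_rhs _ _).
have /choice[C hC] i : exists C : R, 0 <= C /\ forall Q Q' d, family_ball r Q Q' d ->
    0 <= d -> `|riccati_rhs Q i
     - lifted (compress0 (riccati_rhs Q ord0)) (compress1 (riccati_rhs Q i1)) i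
     - (riccati_rhs Q' i
     - lifted (compress0 (riccati_rhs Q' ord0)) (compress1 (riccati_rhs Q' i1)) i)|
     <= C * d.
  have [C C0 hC] := lip_defect i; exists C; split => // Q Q' d QQ' d0.
  by have [] := hC Q Q' d QQ' d0.
have C0 i : 0 <= C i by case: (hC i).
have ZW : forall s : R, 0 <= s <= T -> Z s = W s.
  apply: (ode_unique (C := \sum_i C i) dZ dW).
    case: hP => _ e0 _ e1; apply: eq_mxrow => i; rewrite /L0 /L1 e0 (e1 _ i1neq0).
    rewrite Q0fjointE QfjointE /compress0 /compress1.
    rewrite !compressK ?state2_invK ?state3_invK ?congr_sym//.
    rewrite /lifted; have [->|i0] := eqVneq i ord0; first by rewrite e0 Q0fjointE.
    by rewrite e1// QfjointE.
  move=> s sT; rewrite -mxrowB.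
  apply: norm_mxrow_le => [|i]; first by rewrite mulr_ge0// sumr_ge0.
  have Cs : C i <= \sum_i C i.
    by rewrite (bigD1 i)//= lerDl sumr_ge0.
  apply: (@le_trans _ _ (C i * `|Z s - W s|)); last by rewrite ler_wpM2r.
  have [_ /(_ (P ^~ s) (lifted (L0 s) (L1 s)) `|Z s - W s|)] := hC i.
  rewrite -(lifted_rhs s i) subrr subr0; apply => //; split => j.
  - apply: le_trans (norm_le_mxrow (P ^~ s) j) _.
    by apply: le_trans (hrZ s sT) _; rewrite lerDl ltW.
  - apply: le_trans (norm_le_mxrow (lifted (L0 s) (L1 s)) j) _.
    by apply: le_trans (hrW s sT) _; rewrite lerDr ltW.
  - by rewrite /Z /W -mxrowB; exact: (norm_le_mxrow (fun j => P j s - _ j)).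
move=> i; have := ZW t tT => /(congr1 (fun M => submxrow M i)).
by rewrite !mxrowK.
Qed.

(** Since the solution is a lift, its reduced matrices satisfy the reduced system
    exactly, at [eps = 1 / N]. *)
Lemma riccati_solution_reduced :
  let Y t := block_mx (L0 t) 0 0 (L1 t) in
  ode_on T Y (fun t => reduced_field g (N%:R^-1) (Y t)) /\ Y T = reduced_terminal g.
Proof.
split; last first.
  case: hP => _ e0 _ e1; rewrite /L0 /L1 e0 e1// Q0fjointE QfjointE.
  by rewrite /compress0 /compress1 !compressK ?state2_invK ?state3_invK ?congr_sym.
have s0 t : (L0 t)^T = L0 t by exact: sym_part_tr.
have s1 t : (L1 t)^T = L1 t by exact: sym_part_tr.
have PE (t : R) : 0 <= t <= T -> P ^~ t = lifted (L0 t) (L1 t).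
  by move=> tT; apply/funext => i; exact: riccati_solution_lifted.
apply: reduced_join => t tT.
  have := is_deriv_on_linear (compress_linear (@state2_inv R n N)) (@odeP ord0 t tT).
  apply: is_deriv_on_eq => //; rewrite PE// /riccati_rhs eqxx major_rhs_lifted//.
  by rewrite compressK ?state2_invK// major_field_sym.
have := is_deriv_on_linear (compress_linear (@state3_inv R n N i1)) (@odeP i1 t tT).
apply: is_deriv_on_eq => //; rewrite PE// /riccati_rhs (negbTE i1neq0).
by rewrite minor_rhs_lifted// compressK ?state3_invK// minor_field_sym.
Qed.

End FixedN.

(** The reduced matrices of the games are bounded uniformly in [N] because
    [state2_inv] and [state3_inv] have bounded entries; [limit_solution] then
    applies along [eps = 1 / N]. *)
Theorem asymptotic_reduced : asymptotic_solvability g ->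
  exists2 Y, ode_on T Y (fun t => reduced_field g 0 (Y t)) & Y T = reduced_terminal g.
Proof.
move=> [N0 [P [N0gt0 hP [B hB]]]].
have T0' := ltW T0.
have hPB N t : (N0 <= N)%N -> 0 <= t <= T ->
    l1norm (P N ord0 t) <= `|B| /\ l1norm (P N (inord 1) t) <= `|B|.
  move=> hN tT; have := hB _ (ex_intro _ N (ex_intro _ t (And3 hN tT erefl))).
  have := l1norm_ge0 (P N ord0 t); have := l1norm_ge0 (P N (inord 1) t).
  by have := ler_norm B; move: (`|B|) => b; lra.
apply: (limit_solution T0' (reduced_field_lip g) (r := 4 * 4 * `|B|)).
  by rewrite mulr_ge0.
move=> d d0; have [N2 [_ hN2]] := inv_nat_small d0.
(* At least two minor players are needed to prescribe state and mean. *)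
pose N := maxn 2 (maxn N0 N2).
have N1 : (1 < N)%N by rewrite /N leq_max.
have hN0 : (N0 <= N)%N by rewrite /N !leq_max leqnn orbT.
have hd : N%:R^-1 <= d by rewrite hN2// /N !leq_max leqnn !orbT.
have [hY YT] := riccati_solution_reduced N1 (hP N hN0).
exists N%:R^-1; eexists; split; [|exact: hY|exact: YT|].
  by rewrite invr_ge0 ler0n.
move=> t tT; have [b0 b1] := hPB N t hN0 tT.
have bnd d' m (E : 'M[R]_(m, d')) X : `|E| <= 4 -> l1norm X <= `|B| ->
    `|compress E X| <= 4 * 4 * `|B|.
  move=> E4 XB; apply: le_trans (norm_compress _ _) _.
  by rewrite ler_pM ?mulr_ge0 ?l1norm_ge0// ler_pM.
have c0 : `|compress (@state2_inv R n N) (P N ord0 t)| <= 4 * 4 * `|B|.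
  by apply: bnd => //; apply: le_trans (norm_state2_inv _) _; rewrite ler1n.
have c1 : `|compress (@state3_inv R n N (inord 1)) (P N (inord 1) t)| <= 4 * 4 * `|B|.
  by apply: bnd => //; exact: norm_state3_inv.
have z : 0 <= 4 * 4 * `|B| by rewrite mulr_ge0.
by apply: norm_col_mx_le; apply: norm_row_mx_le; rewrite ?normr0.
Qed.

End GamesToNCE.

(** * The linear system for the offsets *)

Section LinearODE.
Context {R : realType}.
Variables (T : R) (T0 : 0 <= T).

Lemma within_cont_mulmx m k n (A : R -> 'M[R]_(m, k)) (B : R -> 'M[R]_(k, n)) :
  {within `[0, T], continuous A} -> {within `[0, T], continuous B} ->
  {within `[0, T], continuous (fun t => A t *m B t)}.
Proof.
move=> cA cB.
pose Y t : 'M[R]_(m + k, k + n) := block_mx (A t) 0 0 (B t).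
have cY : {within `[0, T], continuous Y}.
  apply/within_contP => t tT e e0.
  have [d d0 hd] := (within_contP _ _).1 cA t tT e e0.
  have [d' d'0 hd'] := (within_contP _ _).1 cB t tT e e0.
  exists (Num.min d d') => [|s sT]; first by rewrite lt_min d0.
  rewrite lt_min => /andP[sd sd'].
  rewrite /Y opp_block_mx add_block_mx !subr0.
  apply: norm_col_mx_le; apply: norm_row_mx_le; rewrite ?normr0 ?(ltW e0)//.
    exact: hd.
  exact: hd'.
pose f (x : R * 'M[R]_(m + k, k + n)) := ulsubmx x.2 *m drsubmx x.2.
have hf r : bounded_lipschitz (param_ball r) f.
  apply: lipM; first exact: lip_lsubmx (lip_usubmx (lip_state _)).
  exact: lip_rsubmx (lip_dsubmx (lip_state _)).
have := lip_within_continuous hf cY.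
rewrite /f /Y (_ : (fun _ => _) = (fun t => A t *m B t))//.
by apply/funext => t /=; rewrite block_mxKul block_mxKdr.
Qed.

(** A linear equation is globally Lipschitz because continuous coefficients are
    bounded on a compact interval. *)
Lemma linear_ode_exists d (A : R -> 'M[R]_d) (b sT : 'cV[R]_d) :
  {within `[0, T], continuous A} ->
  exists2 s, ode_on T s (fun t => A t *m s t + b) & s T = sT.
Proof.
move=> cA; have [M M0 hM] := within_cont_bounded cA.
have K0 : 0 < d%:R * M + 1 by rewrite ltr_wpDl// mulr_ge0// ltW.
apply: (ode_exists (f := fun t x => A t *m x + b) sT T0 K0).
  move=> y cy; apply/within_contP => t tT e e0.
  have [c c0 hc] := (within_contP _ _).1 (within_cont_mulmx cA cy) t tT e e0.
  exists c => // s sT' sd.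
  by rewrite opprD addrACA subrr addr0; exact: hc.
move=> t tT x y; rewrite opprD addrACA subrr addr0 -mulmxBr.
apply: le_trans (ler_norm_mulmx _ _) _; rewrite ler_wpM2r//.
by rewrite (@le_trans _ _ (d%:R * M)) ?lerDl// ler_wpM2l// hM.
Qed.

End LinearODE.

Section Offset.
Context {R : realType} {n n1 n2 : nat}.
Variable g : game_data R n n1 n2.
Hypothesis T0 : 0 < horizon g.
Local Notation dim2 := (n + n)%N.
Local Notation dim3 := (n + (n + n))%N.
Local Notation T := (horizon g).
Local Notation rho := (discount g).

Let mean_gain : 'M[R]_(n, dim3) := B_ g *m invmx (R_ g) *m (bbB g)^T.

(** The coefficient matrix of system (ii) for the stacked offsets, after the mean
    field offset has been eliminated through its formula in [s_1]. *)
Definition offset_matrix (L0 : 'M[R]_dim2) (L1 : 'M[R]_dim3) (Ab Gb : 'M[R]_n) :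
    'M[R]_(dim2 + dim3) :=
  block_mx
    (rho%:M - ((bbA0 g Ab Gb)^T - L0 *m bbB0 g *m invmx (R_0 g) *m (bbB0 g)^T))
    (L0 *m col_mx 0 mean_gain)
    (L1 *m col_mx 0 (bbB0 g *m invmx (R_0 g) *m (bbB0 g)^T))
    (rho%:M - ((bbA g L0 Ab Gb)^T - L1 *m bbB g *m invmx (R_ g) *m (bbB g)^T)
     + L1 *m col_mx 0 (col_mx 0 mean_gain)).

Lemma lip_offset_matrix r : bounded_lipschitz (param_ball r) (fun x =>
  offset_matrix (ulsubmx x.2) (drsubmx x.2)
    (Abar_eps g x.1 (drsubmx x.2)) (Gbar_eps g x.1 (drsubmx x.2))).
Proof.
have h0 := @lip_ulsubmx R n r; have h1 := @lip_drsubmx R n r.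
have hA0 := lip_bbA0 g r; have hA := lip_bbA g r.
apply: lip_block_mx.
- apply: lipB; first exact: lip_cst.
  apply: lipB; first exact: lip_tr.
  by do ?apply: lipM => //; exact: lip_cst.
- by apply: lipM => //; exact: lip_cst.
- by apply: lipM => //; exact: lip_cst.
apply: lipD; last by apply: lipM => //; exact: lip_cst.
apply: lipB; first exact: lip_cst.
apply: lipB; first exact: lip_tr.
by do ?apply: lipM => //; exact: lip_cst.
Qed.

Lemma offset_matrixE L0 L1 Ab Gb (s0 : 'cV[R]_dim2) (s1 : 'cV[R]_dim3) :
  let mbar := - (mean_gain *m s1) in
  offset_matrix L0 L1 Ab Gb *m col_mx s0 s1 + col_mx (etabar0 g) (etabar g) =
  col_mx
    (rho *: s0 - (((bbA0 g Ab Gb)^T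
       - L0 *m bbB0 g *m invmx (R_0 g) *m (bbB0 g)^T) *m s0
       + L0 *m bbM0 mbar - etabar0 g))
    (rho *: s1 - (((bbA g L0 Ab Gb)^T
       - L1 *m bbB g *m invmx (R_ g) *m (bbB g)^T) *m s1
       + L1 *m bbM g s0 mbar - etabar g)).
Proof.
move=> mbar; rewrite /offset_matrix mul_block_col add_col_mx.
have mE : bbM0 mbar = - (col_mx 0 mean_gain *m s1).
  by rewrite mul_col_mx mul0mx opp_col_mx oppr0.
congr col_mx.
  rewrite mE mulmxBl mul_scalar_mx mulmxN -[L0 *m col_mx _ _ *m s1]mulmxA.
  move: (_ *m s0) (L0 *m (_ *m s1)) (etabar0 g) => a b c.
  by apply/matrixP => i j; rewrite !mxE; ring.
have bE : bbM g s0 mbar = - (col_mx 0 (col_mx 0 mean_gain) *m s1)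
    - col_mx 0 (bbB0 g *m invmx (R_0 g) *m (bbB0 g)^T) *m s0.
  rewrite /bbM mE !mul_col_mx !mul0mx !opp_col_mx add_col_mx !oppr0 addr0.
  by rewrite !add_col_mx !addr0 !add0r.
rewrite bE mulmxDl mulmxBl mul_scalar_mx mulmxBr mulmxN.
rewrite -[L1 *m col_mx 0 (col_mx _ _) *m s1]mulmxA -[L1 *m col_mx 0 _ *m s0]mulmxA.
move: (_ *m s1) (L1 *m (_ *m s0)) (L1 *m (_ *m s1)) (etabar g) => a b c d.
by apply/matrixP => i j; rewrite !mxE; ring.
Qed.

(** Once system (i) is solved, system (ii) is linear with continuous coefficients,
    so it puts no further constraint on solvability. *)
Theorem reduced_nce : (exists2 Y, ode_on T Y (fun t => reduced_field g 0 (Y t)) &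
    Y T = reduced_terminal g) -> nce_solvable g.
Proof.
move=> [Y hY YT]; have cY := ode_on_continuous hY.
pose P0 t := ulsubmx (Y t); pose P1 t := drsubmx (Y t).
pose Ab t := Abar_eps g 0 (P1 t); pose Gb t := Gbar_eps g 0 (P1 t).
have [h0 h1] := reduced_split hY.
have cM : {within `[0, T], continuous
    (fun t => offset_matrix (P0 t) (P1 t) (Ab t) (Gb t))}.
  exact: (lip_within_continuous lip_offset_matrix cY).
have [s hs sT] := linear_ode_exists (ltW T0) (col_mx (etabar0 g) (etabar g))
  (col_mx (- etabar0f g) (- etabarf g)) cM.
pose s0 t := usubmx (s t); pose s1 t := dsubmx (s t).
pose mbar t := - (B_ g *m invmx (R_ g) *m (bbB g)^T *m s1 t).
have sE t : s t = col_mx (s0 t) (s1 t) by rewrite vsubmxK.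
have hs0 : ode_on T s0 _ := fun t tT => is_deriv_on_linear
  (L := fun X : 'cV[R]_(dim2 + dim3) => usubmx X)
  (fun a x y => linearP usubmx a x y) (hs t tT).
have hs1 : ode_on T s1 _ := fun t tT => is_deriv_on_linear
  (L := fun X : 'cV[R]_(dim2 + dim3) => dsubmx X)
  (fun a x y => linearP dsubmx a x y) (hs t tT).
exists P0, P1, Ab, Gb, s0, s1, mbar; split.
- split; [exact: ode_on_continuous h0|exact: ode_on_continuous h1| |].
    exact: (lip_within_continuous (lip_Abar_eps g) cY).
  exact: (lip_within_continuous (lip_Gbar_eps g) cY).
- split; [exact: ode_on_continuous hs0|exact: ode_on_continuous hs1|].
  have dm : ode_on T mbar (fun t => - (mean_gain *m dsubmx
      (offset_matrix (P0 t) (P1 t) (Ab t) (Gb t) *m s t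
       + col_mx (etabar0 g) (etabar g)))).
    move=> t tT.
    apply: (is_deriv_on_linear (L := fun X : 'cV[R]_dim3 => - (mean_gain *m X)) _
      (hs1 t tT)) => a x y.
    by rewrite mulmxDr -scalemxAr opprD scalerN.
  exact: ode_on_continuous dm.
- apply/nce_system_i_reduced; split=> //; split => //.
    by rewrite /P0 YT block_mxKul.
  by rewrite /P1 YT block_mxKdr.
- split => //; split.
  + move=> t tT; apply: (is_deriv_on_eq tT _ _ (hs0 t tT)) => //=.
    by rewrite sE offset_matrixE col_mxKu.
  + by rewrite /s0 sT col_mxKu.
  + move=> t tT; apply: (is_deriv_on_eq tT _ _ (hs1 t tT)) => //=.
    by rewrite sE offset_matrixE col_mxKd.
  + by rewrite /s1 sT col_mxKd.
Qed.

End Offset.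

Theorem theorem7 (R : realType) (n n1 n2 : nat)
    (hn : (0 < n)%N) (hn1 : (0 < n1)%N) (hn2 : (0 < n2)%N)
    (g : game_data R n n1 n2)
    (hT : 0 < horizon g) (hrho : 0 <= discount g)
    (hQ0 : sym_psd (Q_0 g)) (hQ0f : sym_psd (Q_0f g))
    (hQ : sym_psd (Q_ g)) (hQf : sym_psd (Q_f g))
    (hR0 : sym_pd (R_0 g)) (hR : sym_pd (R_ g)) :
  nce_solvable g <-> asymptotic_solvability g.
Proof.
case: hQ0 hQ0f hQ hQf hR0 hR => sQ0 _ [sQ0f _] [sQ _] [sQf _] [sR0 _] [sR _].
split; first exact: nce_asymptotic.
by move=> /asymptotic_reduced h; apply: reduced_nce => //; exact: h.
Qed.
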